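(* For triples $(\omega,\mathcal H,f)\in S_1$, with $\mathcal H=\{h=0\}$, $h(0)=0$, $dh(0)\ne0$, the number $$\kappa=\frac{\{h,\{f,h\}\}(0)}{\left(\{f,\{f,h\}\}(0)\right)^2}$$ is an invariant in the classification of triples up to equivalence (in particular it does not depend on the choice of the function $h$ defining $\mathcal H$). Moreover, $\kappa=\dfrac{1}{2g'(0)}$ for each of the following triples: (i) on $\mathbb R^2(x,y)$: $\ \omega=dx\wedge dg(y)$, $\ \mathcal H=\{y+x^2=0\}$, $\ f=g(y)$, $\ g'(0)\neq0$; (ii) on $\mathbb R^{2n+2}(x,y,p,q)$, $n\ge1$, $p=(p_1,\dots,p_n)$, $q=(q_1,\dots,q_n)$: $\ \omega=dx\wedge dF(y,p,q)+\mu$, $\ \mathcal H=\{y+x^2=0\}$, $\ f=F(y,p,q)$, where $F(y,p,q)=g(y)+\sum_{i=1}^n(p_iy^{2i-2}+q_iy^{2i-1})+y^{2n}\phi(y,p,q)$, $\ g'(0)\neq0$, and $\mu$ is a symplectic $2$-form on $\mathbb R^{2n}(p,q)$.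
   Context: All objects (forms, functions, hypersurfaces, diffeomorphisms) are germs at $0$, and are either all $C^\infty$ or all analytic. A triple $(\omega,\mathcal H,f)$ on $\mathbb R^{2m}$ consists of a symplectic form $\omega$, a smooth hypersurface $\mathcal H=\{h=0\}$, where $h$ is a function germ with $h(0)=0$, $dh(0)\neq 0$, and a function germ $f$ with $f(0)=0$ (so $g(0)=0$ in (i) and (ii)). Two triples are equivalent if there is a local diffeomorphism fixing $0$ that brings the symplectic form, the hypersurface and the function of one triple to those of the other. The Hamiltonian vector field $Z_f$ of $f$ is defined by $Z_f\,\rfloor\,\omega = df$, where $\rfloor$ is the interior product, and $\{f,h\}=Z_f(h)$ is the Poisson bracket with respect to $\omega$. The singularity class $S_1$ consists of the triples $(\omega,\mathcal H,f)$ on $\mathbb R^{2m}$ such that: for $m=1$: $\{f,h\}(0)=0$ and $\{f,\{f,h\}\}(0)\neq 0$; for $m\ge 2$: $\{f,h\}(0)=0$, $\{f,\{f,h\}\}(0)\neq 0$, $\{h,\{f,h\}\}(0)\neq 0$ and $(df\wedge dh)(0)\neq 0$. (These conditions do not depend on the choice of $h$.) A form on $\mathbb R^{2n}(p,q)$ is regarded as a form on $\mathbb R^{2n+2}(x,y,p,q)$ by pull-back under the projection $(x,y,p,q)\mapsto(p,q)$. *)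

(* Defs.v *)
From HB Require Import structures.
From mathcomp Require Import all_boot all_order all_algebra.
From mathcomp Require Import all_classical all_reals all_analysis.

Set Implicit Arguments.
Unset Strict Implicit.
Unset Printing Implicit Defensive.

Import Order.TTheory GRing.Theory Num.Theory.
Import numFieldNormedType.Exports.

Local Open Scope classical_set_scope.
Local Open Scope ring_scope.

(* A germ at 0 is represented by a total function (resp. set); all the notions
   below depend only on its restriction to some neighbourhood of 0. *)

Fixpoint Ck_on (R : realType) (n : nat) (U : set 'rV[R]_n) (k : nat)
    (f : 'rV[R]_n -> R) : Prop :=
  if k is k'.+1 then
    forall i : 'I_n, (forall x, U x -> derivable f x (delta_mx 0 i)) /\
      Ck_on U k' (fun x => 'D_(delta_mx 0 i) f x)
  else forall x, U x -> {for x, continuous f}.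

Definition smooth_germ (R : realType) (n : nat) (f : 'rV[R]_n -> R) : Prop :=
  exists U : set 'rV[R]_n,
    [/\ open U, U 0 & forall k : nat, Ck_on U k f].

Definition powser_term (R : realType) (n : nat) (c : {ffun 'I_n -> nat} -> R)
    (x : 'rV[R]_n) (a : {ffun 'I_n -> nat}) : R :=
  c a * \prod_(i < n) x 0 i ^+ a i.

(* The norm of 'rV[R]_n is the max norm, so `|x| < r is a polydisc. The sums
   range over the multi-indices whose entries are all < N. *)
Definition analytic_germ (R : realType) (n : nat) (f : 'rV[R]_n -> R) : Prop :=
  exists (c : {ffun 'I_n -> nat} -> R) (r : R), 0 < r /\
    forall x : 'rV[R]_n, `|x| < r ->
      cvgn (fun N : nat => \sum_(a : {ffun 'I_n -> 'I_N})
              `|powser_term c x [ffun i => a i : nat]|) /\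
      (fun N : nat => \sum_(a : {ffun 'I_n -> 'I_N})
              powser_term c x [ffun i => a i : nat]) @ \oo --> f x.

Inductive category := Smooth | Analytic.

Definition of_class (cat : category) (R : realType) (n : nat)
    (f : 'rV[R]_n -> R) : Prop :=
  match cat with
  | Smooth => smooth_germ f
  | Analytic => analytic_germ f
  end.

Definition map_of_class (cat : category) (R : realType) (n k : nat)
    (Phi : 'rV[R]_n -> 'rV[R]_k) : Prop :=
  forall j : 'I_k, of_class cat (fun x => Phi x 0 j).

Definition diffeo_germ (cat : category) (R : realType) (n : nat)
    (Phi : 'rV[R]_n -> 'rV[R]_n) : Prop :=
  [/\ map_of_class cat Phi, Phi 0 = 0 &
   exists Psi : 'rV[R]_n -> 'rV[R]_n,
     [/\ map_of_class cat Psi, Psi 0 = 0,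
         \forall x \near (0 : 'rV[R]_n), Psi (Phi x) = x &
         \forall x \near (0 : 'rV[R]_n), Phi (Psi x) = x]].

(* The 1-form df, as its row of coefficients (df/dx_i)_i. *)
Definition dform (R : realType) (n : nat) (f : 'rV[R]_n -> R) (x : 'rV[R]_n) :
    'rV[R]_n :=
  \row_(i < n) 'd f x (delta_mx 0 i).

(* A 2-form is given by the matrix W(x) of its coefficients, with
   omega_x(u, v) = u *m W x *m v^T for row vectors u, v. *)
Definition two_form (R : realType) (n : nat) := 'rV[R]_n -> 'M[R]_n.

(* (a /\ b)(u, v) = a(u) b(v) - a(v) b(u). *)
Definition wedge (R : realType) (n : nat) (a b : 'rV[R]_n) : 'M[R]_n :=
  a^T *m b - b^T *m a.

(* With MathComp's row convention, dPhi_x(u) = u *m 'J Phi x. *)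
Definition pullback (R : realType) (n k : nat) (Phi : 'rV[R]_n -> 'rV[R]_k)
    (omega : two_form R k) : two_form R n :=
  fun x => 'J Phi x *m omega (Phi x) *m ('J Phi x)^T.

Definition closed_form (R : realType) (n : nat) (omega : two_form R n) : Prop :=
  \forall x \near (0 : 'rV[R]_n), forall i j k : 'I_n,
    'D_(delta_mx 0 i) (fun z => omega z j k) x
    + 'D_(delta_mx 0 j) (fun z => omega z k i) x
    + 'D_(delta_mx 0 k) (fun z => omega z i j) x = 0.

Definition symplectic_germ (cat : category) (R : realType) (n : nat)
    (omega : two_form R n) : Prop :=
  [/\ forall i j : 'I_n, of_class cat (fun x => omega x i j),
      \forall x \near (0 : 'rV[R]_n), (omega x)^T = - omega x,
      \forall x \near (0 : 'rV[R]_n), omega x \in unitmx &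
      closed_form omega].

(* The solution Z of Z _| omega = df, i.e. omega(Z, v) = df(v) for all v. *)
Definition hamvf (R : realType) (n : nat) (omega : two_form R n)
    (f : 'rV[R]_n -> R) : 'rV[R]_n -> 'rV[R]_n :=
  fun x => dform f x *m invmx (omega x).

Lemma hamvfP (R : realType) (n : nat) (omega : two_form R n)
    (f : 'rV[R]_n -> R) (x Z : 'rV[R]_n) : omega x \in unitmx ->
  Z *m omega x = dform f x <-> Z = hamvf omega f x.
Proof.
move=> u; split=> [E|->]; last by rewrite /hamvf mulmxKV.
by rewrite /hamvf -E mulmxK.
Qed.

Definition poisson (R : realType) (n : nat) (omega : two_form R n)
    (f h : 'rV[R]_n -> R) : 'rV[R]_n -> R :=
  fun x => 'd h x (hamvf omega f x).

Record triple (R : realType) (m : nat) := Triple {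
  form : two_form R m.*2;
  hyper : set 'rV[R]_(m.*2);
  func : 'rV[R]_(m.*2) -> R }.

Definition defines_hyper (cat : category) (R : realType) (n : nat)
    (h : 'rV[R]_n -> R) (H : set 'rV[R]_n) : Prop :=
  [/\ of_class cat h, h 0 = 0, dform h 0 != 0 &
      \forall x \near (0 : 'rV[R]_n), H x <-> h x = 0].

Definition is_triple (cat : category) (R : realType) (m : nat)
    (T : triple R m) : Prop :=
  [/\ symplectic_germ cat (form T),
      exists h, defines_hyper cat h (hyper T),
      of_class cat (func T) &
      func T 0 = 0].

Definition S1_conditions (R : realType) (m : nat) (omega : two_form R m.*2)
    (h f : 'rV[R]_(m.*2) -> R) : Prop :=
  [/\ poisson omega f h 0 = 0,
      poisson omega f (poisson omega f h) 0 != 0 &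
      (2 <= m)%N ->
        poisson omega h (poisson omega f h) 0 != 0 /\
        wedge (dform f 0) (dform h 0) != 0].

Definition in_S1 (cat : category) (R : realType) (m : nat) (T : triple R m) :
    Prop :=
  is_triple cat T /\
  exists h, defines_hyper cat h (hyper T) /\ S1_conditions (form T) h (func T).

Definition equivalent (cat : category) (R : realType) (m : nat)
    (T1 T2 : triple R m) : Prop :=
  exists Phi : 'rV[R]_(m.*2) -> 'rV[R]_(m.*2),
    [/\ diffeo_germ cat Phi,
        \forall x \near (0 : 'rV[R]_(m.*2)),
          form T1 x = pullback Phi (form T2) x,
        \forall x \near (0 : 'rV[R]_(m.*2)),
          hyper T1 x <-> hyper T2 (Phi x) &
        \forall x \near (0 : 'rV[R]_(m.*2)), func T1 x = func T2 (Phi x)].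

Definition kappa (R : realType) (m : nat) (T : triple R m)
    (h : 'rV[R]_(m.*2) -> R) : R :=
  poisson (form T) h (poisson (form T) (func T) h) 0
  / poisson (form T) (func T) (poisson (form T) (func T) h) 0 ^+ 2.

(* The coordinates on R^(2n+2) are (x, y, p_1, ..., p_n, q_1, ..., q_n), in this
   order; n = 0 gives R^2(x, y). *)
Definition xcoord (R : realType) (n : nat) (z : 'rV[R]_(n.+1.*2)) : R :=
  z 0 (inord 0 : 'I_(n.*2.+2)).

Definition ycoord (R : realType) (n : nat) (z : 'rV[R]_(n.+1.*2)) : R :=
  z 0 (inord 1 : 'I_(n.*2.+2)).

Definition proj_ypq (R : realType) (n : nat) (z : 'rV[R]_(n.+1.*2)) :
    'rV[R]_(n.*2.+1) :=
  col' (ord0 : 'I_(n.*2.+2)) z.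

Definition proj_pq (R : realType) (n : nat) (z : 'rV[R]_(n.+1.*2)) :
    'rV[R]_(n.*2) :=
  col' (ord0 : 'I_(n.*2.+1)) (proj_ypq z).

Definition parabola (R : realType) (n : nat) : set 'rV[R]_(n.+1.*2) :=
  [set z | ycoord z + xcoord z ^+ 2 = 0].

Definition triple_plane (R : realType) (g : R -> R) : triple R 1 :=
  Triple (fun z => wedge (dform (@xcoord R 0) z)
                         (dform (fun z => g (@ycoord R 0 z)) z))
         (@parabola R 0)
         (fun z => g (@ycoord R 0 z)).

(* On R^(2n+1)(y, p, q) the indices are y : 0, p_i : i, q_i : n + i
   (1 <= i <= n). *)
Definition Fypq (R : realType) (n : nat) (g : R -> R)
    (phi : 'rV[R]_(n.*2.+1) -> R) (w : 'rV[R]_(n.*2.+1)) : R :=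
  let y := w 0 ord0 in
  let p i := w 0 (inord i) in
  let q i := w 0 (inord (n + i)) in
  g y
  + \sum_(1 <= i < n.+1) (p i * y ^+ (2 * i - 2) + q i * y ^+ (2 * i - 1))
  + y ^+ (2 * n) * phi w.

Definition triple_higher (R : realType) (n : nat) (g : R -> R)
    (phi : 'rV[R]_(n.*2.+1) -> R) (mu : two_form R n.*2) : triple R n.+1 :=
  let f z := Fypq g phi (proj_ypq z) in
  Triple (fun z => wedge (dform (@xcoord R n) z) (dform f z)
                   + pullback (@proj_pq R n) mu z)
         (@parabola R n)
         f.

(* Main.v *)
Require Import Defs.
From HB Require Import structures.
From mathcomp Require Import all_boot all_order all_algebra.
From mathcomp Require Import all_classical all_reals all_analysis.
From mathcomp Require Import ring lra.

Set Implicit Arguments.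
Unset Strict Implicit.
Unset Printing Implicit Defensive.

Import Order.TTheory GRing.Theory Num.Theory.
Import numFieldNormedType.Exports.

(* [Z_f] and [Z_h] being tangent to the hypersurface at 0 when [{f,h}(0) = 0], everything
   reduces to first-order facts. If [h] and [h'] have the same zeros, then along the
   hypersurface [dh'] is proportional to [dh], so the smooth function
   [{f,h'} dh(e) - dh'(e) {f,h}] vanishes on it and its differential at 0 kills tangent
   vectors. Writing [dh'(0) = u dh(0)] this gives [{f,{f,h'}}(0) = u {f,{f,h}}(0)] and
   [{h',{f,h'}}(0) = u^2 {h,{f,h}}(0)], hence the independence of [h]; the invariance follows by
   pulling back an equation of the second hypersurface. For the normal forms [Z_f] is the
   coordinate field d/dx, so [{f,h} = 2x], and contracting with d/dy shows that the
   x-component of [Z_h(0)] is [1 / g'(0)]. *)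

Local Open Scope classical_set_scope.
Local Open Scope ring_scope.

(** * Differentials on row vectors *)

(** Writing [h' = u h] with a unit [u] of the given class would require a division theorem in each
    category. No quotient is formed here: the intermediate value theorem alone controls the zero set
    of [h], and two derivatives at 0 suffice. The square in the denominator of [kappa] is what
    balances the factor [u ^+ 2] of the numerator. The long study of $C^k$ functions and power
    series comes from the membership of the normal forms in $S_1$: the coefficients of $dx\wedge dF$
    are partial derivatives of $F$, so each class must be stable under partial derivatives, and
    closedness rests on the equality of mixed derivatives. For the invariance of [kappa], an
    analytic germ is used only through its smoothness. Both normal forms are instances of one model,
    $dx\wedge dF+\mu$ with $F$ independent of $x$; the plane is the case $n=0$, with $\mu$ the zero
    form on $\mathbb R^0$. *)

Lemma differentiable_sumf (R : realType) (V : normedModType R) (I : Type)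
    (r : seq I) (P : pred I) (F : I -> V -> R) (x : V) :
  (forall i, P i -> differentiable (F i) x) ->
  differentiable (fun y => \sum_(i <- r | P i) F i y) x.
Proof.
move=> dF; elim: r => [|i r IHr].
  by under eq_fun do rewrite big_nil; exact: differentiable_cst.
have [Pi|nPi] := boolP (P i); last first.
  by under eq_fun do rewrite big_cons (negbTE nPi).
under eq_fun do rewrite big_cons Pi.
by apply: differentiableD => //; exact: dF.
Qed.

Lemma differentiable_prodf (R : realType) (V : normedModType R) (I : Type)
    (r : seq I) (P : pred I) (F : I -> V -> R) (x : V) :
  (forall i, P i -> differentiable (F i) x) ->
  differentiable (fun y => \prod_(i <- r | P i) F i y) x.
Proof.
move=> dF; elim: r => [|i r IHr].
  by under eq_fun do rewrite big_nil; exact: differentiable_cst.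
have [Pi|nPi] := boolP (P i); last first.
  by under eq_fun do rewrite big_cons (negbTE nPi).
under eq_fun do rewrite big_cons Pi.
by apply: differentiableM => //; exact: dF.
Qed.

Lemma linear_approx_is_diff (R : realType) (V W : normedModType R)
    (f : V -> W) (df : {linear V -> W}) (x : V) : continuous df ->
  (forall e, 0 < e ->
     \forall h \near (0 : V), `|f (h + x) - f x - df h| <= e * `|h|) ->
  is_diff x f df.
Proof.
move=> dfc H.
have lo : f \o shift x = cst (f x) + df +o_ 0 id.
  apply/eqaddoP => e e0; move: (H e e0); apply: filterS => h /=.
  by rewrite opprD addrA.
have dE := diff_unique dfc lo.
by split=> //; apply/diff_locallyP; rewrite dE; split.
Qed.

Lemma differentiable_approx (R : realType) (V W : normedModType R)
    (f : V -> W) (x : V) : differentiable f x -> forall e, 0 < e ->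
  \forall h \near (0 : V), `|f (h + x) - f x - 'd f x h| <= e * `|h|.
Proof.
move=> /diff_locallyP[_ dfx] e e0.
move: dfx => /eqaddoP /(_ e e0); apply: filterS => h /=.
by rewrite opprD addrA.
Qed.

Section Differentials.
Context {R : realType} {n : nat}.
Implicit Types (f : 'rV[R]_n -> R) (x v : 'rV[R]_n).

Lemma norm_rV_le x (i : 'I_n) : `|x 0 i| <= `|x|.
Proof.
rewrite [leRHS]/Num.norm /= mx_normrE.
by apply: le_trans (le_bigmax _ _ (0, i)).
Qed.

Lemma norm_delta_mx (i : 'I_n) : `|delta_mx 0 i : 'rV[R]_n| = 1.
Proof.
apply/eqP; rewrite eq_le; apply/andP; split; last first.
  apply: le_trans (norm_rV_le _ i).
  by rewrite mxE !eqxx normr1.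
rewrite /Num.norm /= mx_normrE; apply: bigmax_le => //= -[j k] _ /=.
by rewrite mxE; case: (_ && _); rewrite ?normr1 ?normr0.
Qed.

Lemma diff_dform f x v : 'd f x v = \sum_i v 0 i * dform f x 0 i.
Proof.
rewrite {1}(row_sum_delta v) linear_sum; apply: eq_bigr => i _.
by rewrite linearZ /= mxE.
Qed.

Lemma dformE f x i : differentiable f x -> dform f x 0 i = 'D_(delta_mx 0 i) f x.
Proof. by move=> df; rewrite mxE deriveE. Qed.

(** Epsilon form of differentiability, with the differential given by a row of coefficients; most
    explicit differentials below are identified through it. *)
Lemma eps_is_diff f x (c : 'rV[R]_n) :
  (forall e, 0 < e -> \forall h \near (0 : 'rV[R]_n),
     `|f (h + x) - f x - \sum_i h 0 i * c 0 i| <= e * `|h|) ->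
  is_diff x f (fun h : 'rV[R]_n => \sum_i h 0 i * c 0 i).
Proof.
move=> H; pose l := fun h : 'rV[R]_n => \sum_i h 0 i * c 0 i.
have llin : linear l.
  move=> k u v; rewrite /l scaler_sumr -big_split /=; apply: eq_bigr => i _.
  by rewrite !mxE mulrDl [_ *: _]mulrA.
pose lM := GRing.isLinear.Build _ _ _ _ _ llin.
pose lL : {linear 'rV[R]_n -> R} := HB.pack l lM.
have lc : continuous lL.
  move=> y; apply: differentiable_continuous; rewrite /= /l.
  apply: differentiable_sumf => i _; apply: differentiableM => //.
  exact: differentiable_coord.
exact: (linear_approx_is_diff lc H).
Qed.

(** The differential depends only on the germ: the approximation estimate carries over because [f]
    and [g] agree near [x] and at [x] itself. *)
Lemma near_eq_is_diff f g x l :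
  (\forall y \near x, f y = g y) -> is_diff x f l -> is_diff x g l.
Proof.
move=> fg df.
have d := @ex_diff _ _ _ _ _ _ _ df; have lE := @diff_val _ _ _ _ _ _ _ df.
have gE e : 0 < e -> \forall h \near (0 : 'rV[R]_n),
   `|g (h + x) - g x - \sum_i h 0 i * dform f x 0 i| <= e * `|h|.
  move=> e0; have := differentiable_approx d e0.
  move: (fg); rewrite (near_shift 0 x) subr0.
  apply: filterS2 => h /= <-; rewrite (nbhs_singleton fg).
  by rewrite diff_dform.
have [dg Eg] := eps_is_diff gE.
split=> //; rewrite Eg -lE; apply/funext => h.
by rewrite diff_dform.
Qed.

Lemma near_eq_differentiable f g x :
  (\forall y \near x, f y = g y) -> differentiable f x -> differentiable g x.
Proof.
by move=> fg /differentiableP df; case: (near_eq_is_diff fg df).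
Qed.

Lemma near_eq_dform f g x : differentiable f x ->
  (\forall y \near x, f y = g y) -> dform f x = dform g x.
Proof.
move=> /differentiableP df fg; have [_ E] := near_eq_is_diff fg df.
by apply/rowP => i; rewrite !mxE E.
Qed.

End Differentials.

(** * Mean value theorem along a line and the $C^1$ criterion *)

Section LineMVT.
Context {R : realType} {V : normedModType R}.
Implicit Types (f : V -> R) (x v : V).

Lemma is_derive_line f x v (s : R) : derivable f (x + s *: v) v ->
  is_derive s (1 : R) (fun s => f (x + s *: v)) ('D_v f (x + s *: v)).
Proof.
move=> df; set g := fun s => _.
have gE : (fun h : R => h^-1 *: ((g \o shift s) (h *: 1) - g s)) =
    (fun h : R => h^-1 *: ((f \o shift (x + s *: v)) (h *: v) - f (x + s *: v))).
  apply/funext => h /=; rewrite /g; congr (_ *: (f _ - _)).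
  by rewrite [h *: 1]mulr1 scalerDl addrCA.
by split; rewrite /derivable /derive gE.
Qed.

(** Absolute values in the bounds on [s] let one statement serve both signs of [t]; for negative [t]
    the segment runs from [t] to 0. *)
Lemma mvt_line f x v (t : R) :
  (forall s, `|s| <= `|t| -> derivable f (x + s *: v) v) ->
  exists2 s, `|s| <= `|t| & f (x + t *: v) - f x = t * 'D_v f (x + s *: v).
Proof.
move=> df; pose g (s : R) : R := f (x + s *: v).
pose dg (s : R) : R := 'D_v f (x + s *: v).
have mvt (a b : R) : a <= b -> (forall s, s \in `[a, b] -> `|s| <= `|t|) ->
    exists2 s, `|s| <= `|t| & g b - g a = dg s * (b - a).
  move=> ab abt.
  have dg' s : s \in `[a, b] -> is_derive s (1 : R) g (dg s).
    by move=> sab; apply: is_derive_line; apply: df; exact: abt.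
  have gc : {within `[a, b], continuous g}.
    apply: derivable_within_continuous => s sab.
    by have [] := dg' s sab.
  have go s : s \in `]a, b[ -> is_derive s (1 : R) g (dg s).
    by rewrite in_itv => /andP[? ?]; apply: dg'; rewrite in_itv /= !ltW.
  have [s sab E] := MVT_segment ab go gc.
  by exists s => //; exact: abt.
have [t0|t0] := leP 0 t.
- have [|s st] := mvt _ _ t0.
    by move=> s; rewrite in_itv /= => /andP[s0 st]; rewrite !ger0_norm.
  by rewrite /g scale0r addr0 subr0 mulrC => E; exists s.
- have [|s st] := mvt _ _ (ltW t0).
    move=> s; rewrite in_itv /= => /andP[ts s0].
    by rewrite !ler0_norm ?lerN2 // ltW.
  rewrite /g scale0r addr0 sub0r => E; exists s => //.
  by rewrite -opprB E mulrN opprK mulrC.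
Qed.

End LineMVT.

Section C1.
Context {R : realType} {n : nat}.
Implicit Types (f : 'rV[R]_n -> R) (x v : 'rV[R]_n).

(** One passes from [x] to [x + h] by moving one coordinate at a time. By the mean value theorem
    each move contributes [h 0 j] times a partial derivative at an intermediate point, which
    continuity keeps close to its value at [x]. *)
Lemma continuous_partials_is_diff f x :
  (\forall y \near x, forall i, derivable f y (delta_mx 0 i)) ->
  (forall i, {for x, continuous (fun y => 'D_(delta_mx 0 i) f y)}) ->
  is_diff x f (fun h : 'rV[R]_n => \sum_i h 0 i * (\row_i 'D_(delta_mx 0 i) f x) 0 i).
Proof.
move=> df cf; apply: eps_is_diff => e e0.
(* Each of the [n] moves may cost [ep] times the norm of [h]; dividing by [n.+1] rather than [n]
   keeps the quotient meaningful for [n = 0]. *)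
pose ep := e / n.+1%:R; have ep0 : 0 < ep by rewrite divr_gt0.
have : \forall y \near x, (forall i, derivable f y (delta_mx 0 i)) /\
    forall i, `|'D_(delta_mx 0 i) f y - 'D_(delta_mx 0 i) f x| <= ep.
  apply: filterI => //.
  have H i : \forall y \near x, `|'D_(delta_mx 0 i) f y - 'D_(delta_mx 0 i) f x| <= ep.
    by move/cvgrPdistC_le: (cf i) => /(_ ep ep0).
  exact: (@filter_forall _ _ _ _ _ H).
move=> /nbhs_ballP[r /= r0 rP].
have {}rP y : `|y - x| < r -> (forall i, derivable f y (delta_mx 0 i)) /\
    forall i, `|'D_(delta_mx 0 i) f y - 'D_(delta_mx 0 i) f x| <= ep.
  by move=> yx; apply: rP; rewrite -ball_normE /= distrC.
(* Below this bound on [h], the whole broken path, made of at most [n] steps no longer than the norm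
   of [h], stays in the ball of radius [r]. *)
have dn0 : 0 < r / n.+1%:R by rewrite divr_gt0.
have hs : \forall h \near (0 : 'rV[R]_n), `|h| < r / n.+1%:R by exact: nbhs0_lt.
move: hs; apply: filterS => h hs.
have hr : n.+1%:R * `|h| < r.
  by rewrite mulrC -ltr_pdivlMr.
have Sle (s : seq 'I_n) : `|\sum_(j <- s) h 0 j *: (delta_mx 0 j) : 'rV[R]_n| <= (size s)%:R * `|h|.
  elim: s => [|j s IHs]; first by rewrite big_nil normr0 mul0r.
  rewrite big_cons /= -natr1 mulrDl mul1r [leRHS]addrC.
  apply: le_trans (ler_normD _ _) _; apply: lerD => //.
  by rewrite normrZ norm_delta_mx mulr1 norm_rV_le.
(* [s] lists the coordinates already moved; in the induction the new one [j] is moved last, starting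
   from [y]. *)
have main (s : seq 'I_n) : (size s <= n)%N ->
  `|f (x + \sum_(j <- s) h 0 j *: (delta_mx 0 j)) - f x -
     \sum_(j <- s) h 0 j * 'D_(delta_mx 0 j) f x| <= (size s)%:R * (ep * `|h|).
  elim: s => [_|j s IHs sn]; first by rewrite !big_nil addr0 !subrr normr0 mul0r.
  rewrite !big_cons; set y := x + \sum_(j <- s) h 0 j *: (delta_mx 0 j).
  have near_y t : `|t| <= `|h 0 j| -> `|y + t *: (delta_mx 0 j) - x| < r.
    move=> th; apply: le_lt_trans hr; rewrite /y addrAC (addrC x) addrK.
    apply: le_trans (ler_normD _ _) _.
    apply: (@le_trans _ _ ((size s)%:R * `|h| + `|h|)).
      apply: lerD; first exact: Sle.
      by rewrite normrZ norm_delta_mx mulr1 (le_trans th) // norm_rV_le.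
    rewrite -[X in _ + X]mul1r -mulrDl natr1 ler_wpM2r // ler_nat.
    by rewrite ltnS ltnW.
  have [|t th tE] := @mvt_line _ _ f y (delta_mx 0 j) (h 0 j).
    by move=> t th; have [] := rP _ (near_y t th).
  have -> : x + (h 0 j *: (delta_mx 0 j) + \sum_(j0 <- s) h 0 j0 *: (delta_mx 0 j0)) =
      y + h 0 j *: (delta_mx 0 j).
    by rewrite /y -addrA [X in x + X]addrC.
  have -> : f (y + h 0 j *: (delta_mx 0 j)) - f x - (h 0 j * 'D_(delta_mx 0 j) f x +
      \sum_(j0 <- s) h 0 j0 * 'D_(delta_mx 0 j0) f x) =
      h 0 j * ('D_(delta_mx 0 j) f (y + t *: (delta_mx 0 j)) - 'D_(delta_mx 0 j) f x) +
      (f y - f x - \sum_(j0 <- s) h 0 j0 * 'D_(delta_mx 0 j0) f x).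
    by rewrite mulrBr -tE; ring.
  rewrite /= -natr1 mulrDl mul1r [leRHS]addrC.
  apply: le_trans (ler_normD _ _) _; apply: lerD; last exact/IHs/ltnW.
  rewrite normrM mulrC; apply: ler_pM => //; last exact: norm_rV_le.
  by have [_] := rP _ (near_y t th); apply.
have := main (index_enum 'I_n).
have -> : size (index_enum 'I_n) = n by rewrite -sum1_size sum1_card card_ord.
have -> : \sum_(j <- index_enum 'I_n) h 0 j *: (delta_mx 0 j) = h by rewrite [RHS]row_sum_delta.
have -> : \sum_i h 0 i * (\row_i0 'D_(delta_mx 0 i0) f x) 0 i =
    \sum_i h 0 i * 'D_(delta_mx 0 i) f x.
  by apply: eq_bigr => i _; rewrite mxE.
rewrite [h + x]addrC => /(_ (leqnn n)).
move=> /le_trans; apply.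
rewrite mulrA ler_wpM2r // /ep mulrCA ler_piMr ?ltW//.
by rewrite ltr_pdivrMr // mul1r ltr_nat.
Qed.

Lemma continuous_partials_differentiable f x :
  (\forall y \near x, forall i, derivable f y (delta_mx 0 i)) ->
  (forall i, {for x, continuous (fun y => 'D_(delta_mx 0 i) f y)}) ->
  differentiable f x.
Proof. by move=> df cf; have [] := continuous_partials_is_diff df cf. Qed.

End C1.

(** * Functions of class C^k *)

Section MixedPartials.
Context {R : realType} {n : nat}.
Implicit Types (f : 'rV[R]_n -> R) (x v : 'rV[R]_n).

Lemma growth_rate_translate f (v w y : 'rV[R]_n) :
  (fun h : R => h^-1 *: (((fun z => f (z + w)) \o shift y) (h *: v) - f (y + w))) =
  (fun h : R => h^-1 *: ((f \o shift (y + w)) (h *: v) - f (y + w))).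
Proof. by apply/funext => h /=; rewrite addrA. Qed.

Lemma derivable_translate f (v w y : 'rV[R]_n) :
  derivable f (y + w) v -> derivable (fun z => f (z + w)) y v.
Proof. by rewrite /derivable growth_rate_translate. Qed.

Lemma derive_translate f (v w y : 'rV[R]_n) :
  'D_v (fun z => f (z + w)) y = 'D_v f (y + w).
Proof. by rewrite /derive growth_rate_translate. Qed.

(** The second difference is the increment in direction [e_i] of [g z = f (z + t e_j) - f z]. The
    mean value theorem, applied to [g] and then to [D_i f] in direction [e_j], turns it into
    [t ^+ 2] times the mixed derivative at a nearby point. *)
Lemma mixed_difference f x (i j : 'I_n) :
  (\forall y \near x, derivable f y (delta_mx 0 i)) ->
  (\forall y \near x, derivable (fun z => 'D_(delta_mx 0 i) f z) y (delta_mx 0 j)) ->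
  {for x, continuous (fun y => 'D_(delta_mx 0 j) (fun z => 'D_(delta_mx 0 i) f z) y)} ->
  forall e, 0 < e -> \forall t \near (0 : R),
   `|f (x + t *: delta_mx 0 i + t *: delta_mx 0 j) - f (x + t *: delta_mx 0 i) -
     f (x + t *: delta_mx 0 j) + f x -
     t ^+ 2 * 'D_(delta_mx 0 j) (fun z => 'D_(delta_mx 0 i) f z) x| <= e * t ^+ 2.
Proof.
set ei : 'rV[R]_n := delta_mx 0 i; set ej : 'rV[R]_n := delta_mx 0 j.
move=> df ddf cf e e0.
have : \forall y \near x, [/\ derivable f y ei,
   derivable (fun z => 'D_ei f z) y ej &
   `|'D_ej (fun z => 'D_ei f z) y - 'D_ej (fun z => 'D_ei f z) x| <= e].
  have cf' : \forall y \near x,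
      `|'D_ej (fun z => 'D_ei f z) y - 'D_ej (fun z => 'D_ei f z) x| <= e.
    by move/cvgrPdistC_le: cf => /(_ e e0).
  by apply: filterS3 df ddf cf'.
move=> /nbhs_ballP[r /= r0 rP].
have {}rP (s t : R) : `|s| + `|t| < r -> [/\ derivable f (x + s *: ei + t *: ej) ei,
   derivable (fun z => 'D_ei f z) (x + s *: ei + t *: ej) ej &
   `|'D_ej (fun z => 'D_ei f z) (x + s *: ei + t *: ej) - 'D_ej (fun z => 'D_ei f z) x| <= e].
  move=> st; apply: rP; rewrite -ball_normE /= distrC -(addrA x) (addrC x) addrK.
  apply: le_lt_trans (ler_normD _ _) _.
  by rewrite !normrZ !norm_delta_mx !mulr1.
have r20 : 0 < r / 2 by rewrite divr_gt0.
have : \forall t \near (0 : R), `|t| < r / 2 by exact: nbhs0_lt.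
apply: filterS => t tr.
pose g z := f (z + t *: ej) - f z.
have st (s : R) : `|s| <= `|t| -> `|s| + `|t| < r by move=> ?; lra.
have st0 (s : R) : `|s| <= `|t| -> `|s| + `|0 : R| < r by rewrite normr0 => ?; lra.
have dg s : `|s| <= `|t| -> is_derive (x + s *: ei) ei g
    ('D_ei f (x + s *: ei + t *: ej) - 'D_ei f (x + s *: ei)).
  move=> ss; have [d1 _ _] := rP _ _ (st _ ss).
  have [d2 _ _] := rP _ _ (st0 _ ss); rewrite scale0r addr0 in d2.
  have d3 := @derivable_translate f ei (t *: ej) _ d1.
  split; first exact: (derivableB d3 d2).
  by rewrite (deriveB d3 d2) derive_translate.
have [s ss gE] := @mvt_line _ _ g x ei t (fun s ss => @ex_derive _ _ _ _ _ _ _ (dg s ss)).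
have [s' ss' gE'] := @mvt_line _ _ (fun z => 'D_ei f z) (x + s *: ei) ej t
  (fun s' ss' => let: And3 _ d _ := rP s s' (le_lt_trans (lerD (lexx _) ss') (st s ss)) in d).
have -> : f (x + t *: ei + t *: ej) - f (x + t *: ei) - f (x + t *: ej) + f x =
   g (x + t *: ei) - g x by rewrite /g; ring.
rewrite gE (@derive_val _ _ _ _ _ _ _ (dg s ss)) gE' mulrA -expr2 -mulrBr normrM.
rewrite mulrC [`|t ^+ 2|]ger0_norm ?sqr_ge0 // ler_wpM2r ?sqr_ge0 //.
by have [] := rP s s' (le_lt_trans (lerD (lexx _) ss') (st s ss)).
Qed.

End MixedPartials.

(** Used with [T = t ^+ 2] and [X] a second difference, to compare the two mixed derivatives. *)
Lemma close_quotients (R : realFieldType) (T X A B e : R) : 0 < T ->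
  `|X - T * A| <= e / 2 * T -> `|X - T * B| <= e / 2 * T -> `|A - B| <= e.
Proof.
move=> T0 h1 h2; rewrite -(ler_pM2l T0) -{1}(gtr0_norm T0) -normrM.
have -> : T * (A - B) = (X - T * B) - (X - T * A) by ring.
apply: le_trans (ler_normB _ _) _; apply: le_trans (lerD h2 h1) _.
by rewrite -mulrDl -splitr mulrC.
Qed.

Section Ck.
Context {R : realType} {n : nat}.
Implicit Types (f g : 'rV[R]_n -> R) (x : 'rV[R]_n) (U : set 'rV[R]_n).

Lemma near_open U x : open U -> U x -> \forall y \near x, U y.
Proof. by move=> oU Ux; apply: open_nbhs_nbhs; split. Qed.

Lemma Ck_on_sub U V k f : V `<=` U -> Ck_on U k f -> Ck_on V k f.
Proof.
move=> VU; elim: k f => [|k IHk] f /=; first by move=> cf x /VU; exact: cf.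
by move=> cf i; have [df Df] := cf i; split=> [x /VU|]; [exact: df|exact: IHk].
Qed.

(** Openness of [U] turns equality on [U] into equality near each of its points, so that derivatives
    agree too. *)
Lemma Ck_on_eq U k f g : open U -> (forall x, U x -> f x = g x) ->
  Ck_on U k f -> Ck_on U k g.
Proof.
move=> oU; have nU x : U x -> \forall y \near x, U y by exact: near_open.
elim: k f g => [|k IHk] f g fg /=.
  move=> cf x Ux; have fgx : {near x, f =1 g}.
    by apply: filterS (nU x Ux) => y; exact: fg.
  change (g @ x --> g x); rewrite -(fg x Ux).
  by apply: cvg_trans (cf x Ux); exact: (@near_eq_cvg _ _ (nbhs x) _ _ _ fgx).
move=> cf i; have [df Df] := cf i.
have fgn x : U x -> {near x, f =1 g}.
  by move=> Ux; apply: filterS (nU x Ux) => y; exact: fg.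
split=> [x Ux|]; first exact: near_eq_derivable (fgn x Ux) (df x Ux).
by apply: IHk Df => x Ux; apply: near_eq_derive; exact: fgn.
Qed.

Lemma Ck_on1_differentiable U f x : open U -> Ck_on U 1 f -> U x ->
  differentiable f x.
Proof.
move=> oU cf Ux; have nU := near_open oU Ux.
apply: continuous_partials_differentiable => [|i].
  by apply: filterS nU => y Uy i; have [df _] := cf i; exact: df.
by have [_ c] := cf i; exact: c.
Qed.

Lemma Ck_onW U k f : open U -> Ck_on U k.+1 f -> Ck_on U k f.
Proof.
move=> oU; elim: k f => [|k IHk] f.
  move=> cf x Ux; apply: differentiable_continuous.
  exact: Ck_on1_differentiable cf Ux.
by move=> cf i; have [df Df] := cf i; split; [exact: df|exact: IHk].
Qed.

Lemma Ck_on_cst U k (c : R) : Ck_on U k (fun=> c).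
Proof.
elim: k c => [|k IHk] c /=; first by move=> x _; exact: cst_continuous.
move=> i; split=> [x _|]; first exact: derivable_cst.
have -> : (fun x : 'rV[R]_n => 'D_(delta_mx 0 i) (fun=> c) x) = fun=> 0.
  by apply/funext => x; exact: derive_cst.
exact: IHk.
Qed.

Lemma Ck_onD U k f g : open U ->
  Ck_on U k f -> Ck_on U k g -> Ck_on U k (fun x => f x + g x).
Proof.
move=> oU; elim: k f g => [|k IHk] f g /=.
  by move=> cf cg x Ux; exact: (continuousD (cf x Ux) (cg x Ux)).
move=> cf cg i; have [df Df] := cf i; have [dg Dg] := cg i.
split=> [x Ux|]; first by apply: derivableD; [exact: df|exact: dg].
apply: Ck_on_eq (IHk _ _ Df Dg) => // x Ux.
by rewrite deriveD //; [exact: df|exact: dg].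
Qed.

Lemma Ck_onM U k f g : open U ->
  Ck_on U k f -> Ck_on U k g -> Ck_on U k (fun x => f x * g x).
Proof.
move=> oU; elim: k f g => [|k IHk] f g.
  by move=> cf cg x Ux; exact: (continuousM (cf x Ux) (cg x Ux)).
move=> cf cg i; have [df Df] := cf i; have [dg Dg] := cg i.
split=> [x Ux|]; first by apply: derivableM; [exact: df|exact: dg].
have cf' := Ck_onW oU cf; have cg' := Ck_onW oU cg.
apply: Ck_on_eq (Ck_onD oU (IHk _ _ cf' Dg) (IHk _ _ cg' Df)) => // x Ux.
by rewrite deriveM //; [exact: df|exact: dg].
Qed.

Lemma derive_coord (i j : 'I_n) x :
  is_derive x (delta_mx 0 j) (fun z : 'rV[R]_n => z 0 i) ((i == j)%:R : R).
Proof.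
have dc := differentiable_coord x (0 : 'I_1) i.
split; first exact: diff_derivable.
rewrite /derive; apply: lim_near_cst => //.
rewrite near_withinE; near=> h => h0.
by rewrite /= !mxE eqxx /= addrK [LHS]mulrA mulVf // mul1r.
Unshelve. all: by end_near. Qed.

Lemma Ck_on_coord U k (i : 'I_n) : Ck_on U k (fun x : 'rV[R]_n => x 0 i).
Proof.
case: k => [|k] /=; first by move=> x _; exact: coord_continuous.
move=> j; split=> [x _|]; first by have [] := derive_coord i j x.
have -> : (fun x : 'rV[R]_n => 'D_(delta_mx 0 j) (fun z : 'rV[R]_n => z 0 i) x) =
    fun=> (i == j)%:R.
  by apply/funext => x; have [] := derive_coord i j x.
exact: Ck_on_cst.
Qed.

(** Schwarz's theorem: the second difference is symmetric in the two directions and, divided by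
    [t ^+ 2], approximates each of the two mixed derivatives. *)
Lemma Ck_on2_symmetric U f x (i j : 'I_n) : open U -> Ck_on U 2 f -> U x ->
  'D_(delta_mx 0 j) (fun z => 'D_(delta_mx 0 i) f z) x =
  'D_(delta_mx 0 i) (fun z => 'D_(delta_mx 0 j) f z) x.
Proof.
move=> oU cf Ux; have nU := near_open oU Ux.
pose P e k l (t : R) :=
   `|f (x + t *: delta_mx 0 k + t *: delta_mx 0 l) - f (x + t *: delta_mx 0 k) -
     f (x + t *: delta_mx 0 l) + f x -
     t ^+ 2 * 'D_(delta_mx 0 l) (fun z => 'D_(delta_mx 0 k) f z) x| <= e * t ^+ 2.
have M k l : forall e, 0 < e -> \forall t \near (0 : R), P e k l t.
  have [df /(_ l) [ddf cddf]] := cf k.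
  apply: mixed_difference; last exact: cddf.
    by apply: filterS nU => y; exact: df.
  by apply: filterS nU => y; exact: ddf.
set A := LHS; set B := RHS; apply/eqP; rewrite -subr_eq0 -normr_le0.
apply/ler_addgt0Pr => e e0; rewrite add0r; have e20 : 0 < e / 2 by rewrite divr_gt0.
have : \forall t \near (0 : R), P (e / 2) i j t /\ P (e / 2) j i t.
  by apply: filterI; exact: M.
move=> /nbhs_ballP[r /= r0 rP].
have [] := rP (r / 2).
  by rewrite /ball /= sub0r normrN gtr0_norm ?divr_gt0 // ltr_pdivrMr // ltr_pMr // ltr1n.
set t := r / 2; have t20 : 0 < t ^+ 2 by rewrite exprn_gt0 // divr_gt0.
rewrite /P -/A -/B (addrAC x (t *: delta_mx 0 j)) => h1 h2.
apply: (close_quotients t20 h1).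
by rewrite [X in `|X + _ - _|]addrAC.
Qed.

End Ck.

(** * Power series in several variables *)

Section CubeSums.
Context {R : realType}.

(** In [analytic_germ] the index type of the sums changes with the bound. As lists in one fixed
    type, cubes of different sizes can be compared by inclusion. *)
Definition cube (n N : nat) : seq {ffun 'I_n -> nat} :=
  [seq [ffun i => a i : nat] | a : {ffun 'I_n -> 'I_N} <- enum {: {ffun 'I_n -> 'I_N}}].

Lemma cube_uniq n N : uniq (cube n N).
Proof.
rewrite map_inj_uniq ?enum_uniq // => a b /ffunP ab.
by apply/ffunP => i; apply: val_inj; have := ab i; rewrite !ffunE.
Qed.

Lemma mem_cube n N (a : {ffun 'I_n -> nat}) :
  (a \in cube n N) = [forall i, (a i < N)%N].
Proof.
apply/mapP/forallP => [[b _ ->] i|aN]; first by rewrite ffunE.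
exists [ffun i => Ordinal (aN i)]; first by rewrite mem_enum.
by apply/ffunP => i; rewrite !ffunE.
Qed.

Lemma cube_sub n N M : (N <= M)%N -> {subset cube n N <= cube n M}.
Proof.
move=> NM a; rewrite !mem_cube => /forallP aN; apply/forallP => i.
exact: leq_trans (aN i) NM.
Qed.

Lemma sum_cubeE n N (F : {ffun 'I_n -> nat} -> R) :
  \sum_(a : {ffun 'I_n -> 'I_N}) F [ffun i => a i : nat] =
  \sum_(a <- cube n N) F a.
Proof. by rewrite big_map big_enum. Qed.

Lemma sum_uniq_split (T : eqType) (s t : seq T) (F : T -> R) :
  uniq s -> uniq t -> {subset s <= t} ->
  \sum_(a <- t) F a = \sum_(a <- s) F a + \sum_(a <- t | a \notin s) F a.
Proof.
move=> us ut st; rewrite (bigID (mem s)) /=; congr (_ + _).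
rewrite -big_filter; apply/perm_big/uniq_perm => //; first exact: filter_uniq.
by move=> a; rewrite mem_filter andb_idr //; exact: st.
Qed.

(** The convergence requirement of [analytic_germ] detached from power series; operations on
    analytic functions reduce to operations on such families. *)
Definition absum (n : nat) (F : {ffun 'I_n -> nat} -> R) (s : R) : Prop :=
  cvgn (fun N : nat => \sum_(a <- cube n N) `|F a|) /\
  (fun N : nat => \sum_(a <- cube n N) F a) @ \oo --> s.

Lemma sum_cube_le n (F : {ffun 'I_n -> nat} -> R) N M :
  (forall a, 0 <= F a) -> (N <= M)%N ->
  \sum_(a <- cube n N) F a <= \sum_(a <- cube n M) F a.
Proof.
move=> F0 NM; rewrite (sum_uniq_split _ (cube_uniq n N) (cube_uniq n M) (cube_sub NM)).
by rewrite lerDl sumr_ge0.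
Qed.

Lemma cvgn_sum_cube n (F : {ffun 'I_n -> nat} -> R) (C : R) :
  (forall a, 0 <= F a) -> (forall N, \sum_(a <- cube n N) F a <= C) ->
  cvgn (fun N : nat => \sum_(a <- cube n N) F a).
Proof.
move=> F0 FC; apply: nondecreasing_is_cvgn.
  by move=> N M NM; exact: sum_cube_le.
by exists C => _ [N _ <-].
Qed.

Lemma absum_bounded n (F : {ffun 'I_n -> nat} -> R) (s : R) : absum F s ->
  exists C, forall N, \sum_(a <- cube n N) `|F a| <= C.
Proof.
move=> [cF _]; exists (limn (fun N : nat => \sum_(a <- cube n N) `|F a|)) => N.
apply: (nondecreasing_cvgn_le _ cF) => p q pq.
by apply: sum_cube_le.
Qed.

Lemma bounded_absum n (F : {ffun 'I_n -> nat} -> R) (C : R) :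
  (forall N, \sum_(a <- cube n N) `|F a| <= C) -> exists s, absum F s.
Proof.
move=> FC.
have cF : cvgn (fun N : nat => \sum_(a <- cube n N) `|F a|) by exact: cvgn_sum_cube FC.
(* [F] is the difference of [F + |F|] and [|F|], two non-negative families with bounded partial
   sums. *)
have cF' : cvgn (fun N : nat => \sum_(a <- cube n N) (F a + `|F a|)).
  apply: (@cvgn_sum_cube _ _ (C + C)) => [a|N].
    by rewrite -lerBlDr sub0r lerNl -normrN ler_norm.
  rewrite big_split lerD // (le_trans _ (FC N)) //.
  by apply: ler_sum => a _; exact: ler_norm.
exists (limn (fun N : nat => \sum_(a <- cube n N) (F a + `|F a|)) -
   limn (fun N : nat => \sum_(a <- cube n N) `|F a|)); split=> //.
have -> : (fun N : nat => \sum_(a <- cube n N) F a) =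
    (fun N : nat => \sum_(a <- cube n N) (F a + `|F a|) - \sum_(a <- cube n N) `|F a|).
  by apply/funext => N; rewrite big_split /= addrK.
exact: cvgB.
Qed.

Lemma absumD n (F G : {ffun 'I_n -> nat} -> R) (s t : R) :
  absum F s -> absum G t -> absum (fun a => F a + G a) (s + t).
Proof.
move=> Fs Gt; have [C FC] := absum_bounded Fs; have [D GD] := absum_bounded Gt.
split.
  apply: (@cvgn_sum_cube _ _ (C + D)) => // N.
  apply: (@le_trans _ _ (\sum_(a <- cube n N) (`|F a| + `|G a|))).
    by apply: ler_sum => a _; exact: ler_normD.
  by rewrite big_split lerD.
under eq_fun do rewrite big_split /=.
by apply: cvgD; [exact: (proj2 Fs)|exact: (proj2 Gt)].
Qed.

Lemma absumZ n (F : {ffun 'I_n -> nat} -> R) (k s : R) :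
  absum F s -> absum (fun a => k * F a) (k * s).
Proof.
move=> [cF Fs]; split.
  have -> : (fun N : nat => \sum_(a <- cube n N) `|k * F a|) =
      (fun N => `|k| * \sum_(a <- cube n N) `|F a|).
    by apply/funext => N; rewrite mulr_sumr; apply: eq_bigr => a _; rewrite normrM.
  exact: is_cvgMr.
under eq_fun do rewrite -mulr_sumr.
exact: cvgMl_tmp.
Qed.

Lemma absum_unique n (F : {ffun 'I_n -> nat} -> R) (s t : R) :
  absum F s -> absum F t -> s = t.
Proof. by move=> [_ Fs] [_ Ft]; exact: (cvg_unique _ Fs Ft). Qed.

(** Lets estimates valid term by term pass to the sum; continuity and differentiability of power
    series are obtained this way. *)
Lemma absum_norm_le n (F : {ffun 'I_n -> nat} -> R) (s C : R) :
  absum F s -> (forall N, \sum_(a <- cube n N) `|F a| <= C) -> `|s| <= C.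
Proof.
move=> [_ Fs] FC; apply: (cvgr_to_le (cvg_norm Fs)).
apply: nearW => N; apply: le_trans (FC N).
exact: ler_norm_sum.
Qed.

(** [G] is [F] transported along [p] and extended by zero. The injection need not send cubes onto
    cubes, but by the last two inclusions the cube of size [N.+1] for [G] corresponds to an index
    set lying between the cubes of sizes [N] and [N.+1] for [F]. The partial sums thus differ by at
    most one increment of the sums of [|F|], which tends to 0. *)
Lemma absum_reindex n k (F : {ffun 'I_k -> nat} -> R)
    (G : {ffun 'I_n -> nat} -> R)
    (p : {ffun 'I_k -> nat} -> {ffun 'I_n -> nat}) (s : R) :
  injective p -> (forall b, G (p b) = F b) ->
  (forall a, G a != 0 -> exists b, a = p b) ->
  (forall N b, p b \in cube n N -> b \in cube k N) ->
  (forall N b, b \in cube k N -> p b \in cube n N.+1) ->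
  absum F s -> absum G s.
Proof.
move=> pI GF G0 pN Np Fs.
(* By [pN] this is the full preimage under [p] of the cube of size [N]. *)
pose E N := [seq b <- cube k N | p b \in cube n N].
have EG (H : R -> R) N : H 0 = 0 ->
    \sum_(a <- cube n N) H (G a) = \sum_(b <- E N) H (F b).
  move=> H0; have uE : uniq (map p (E N)).
    by rewrite map_inj_uniq // filter_uniq // cube_uniq.
  rewrite (sum_uniq_split _ uE (cube_uniq n N)); last first.
    by move=> a /mapP[b]; rewrite mem_filter => /andP[? _] ->.
  rewrite big_map [X in _ + X]big_seq_cond [X in _ + X]big1 ?addr0.
    by apply: eq_bigr => b _; rewrite GF.
  move=> a /andP[aN apE]; have [->//|/G0[b ab]] := eqVneq (G a) 0.
  case/negP: apE; rewrite ab map_f // mem_filter -ab aN /=.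
  by apply: pN; rewrite -ab.
have Esub N : {subset E N <= cube k N} by move=> b; rewrite mem_filter => /andP[].
have uE N : uniq (E N) by rewrite filter_uniq // cube_uniq.
have [C FC] := absum_bounded Fs.
have GC N : \sum_(a <- cube n N) `|G a| <= C.
  rewrite (EG Num.norm) ?normr0 //; apply: le_trans (FC N).
  by rewrite (sum_uniq_split _ (uE N) (cube_uniq k N) (Esub N)) lerDl sumr_ge0.
split; first exact: cvgn_sum_cube GC.
case: Fs => cF Fs.
pose S N := \sum_(b <- cube k N) `|F b|.
have cS1 : S N.+1 - S N @[N --> \oo] --> (0 : R).
  rewrite -(subrr (limn S)); apply: cvgB; last exact: cF.
  by rewrite (cvg_shiftS S); exact: cF.
rewrite -(cvg_shiftS (fun N => \sum_(a <- cube n N) G a)).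
have -> : (fun N => \sum_(a <- cube n N.+1) G a) =
  (fun N => \sum_(b <- cube k N.+1) F b -
    (\sum_(b <- cube k N.+1) F b - \sum_(a <- cube n N.+1) G a)).
  by apply/funext => N; rewrite opprB addrC subrK.
rewrite -[s]subr0; apply: cvgB; first by rewrite (cvg_shiftS (fun N => \sum_(b <- cube k N) F b)).
apply/norm_cvg0P.
apply: (squeeze_cvgr _ (@cvg_cst _ _ _ _ _) cS1).
apply: nearW => N; rewrite normr_ge0 /=.
rewrite (EG id) // (sum_uniq_split _ (uE N.+1) (cube_uniq k N.+1) (Esub N.+1)) addrC addKr.
apply: le_trans (ler_norm_sum _ _ _) _.
rewrite lerBrDr /S (sum_uniq_split _ (uE N.+1) (cube_uniq k N.+1) (Esub N.+1)) addrC lerD2r.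
have NE : {subset cube k N <= E N.+1}.
  by move=> b bN; rewrite mem_filter Np // (cube_sub (leqnSn N)).
by rewrite (sum_uniq_split _ (cube_uniq k N) (uE N.+1) NE) lerDl sumr_ge0.
Qed.

End CubeSums.

(** * Bounds on powers, uniform in the exponent *)

Section PowerDifferences.
Context {R : realType}.
Variables (d M : R).
Hypotheses (d0 : 0 <= d) (M0 : 0 <= M).

Lemma pow_le (y : R) k : `|y| <= M + d -> `|y ^+ k| <= (M + d) ^+ k.
Proof. by move=> yM; rewrite normrX lerXn2r // nnegrE addr_ge0. Qed.

(** No factor [k] appears on the right: it is absorbed by enlarging the radius from [M] to [M + d],
    in the spirit of Cauchy's estimates, so that summing against the coefficients of a series only
    requires convergence at the larger radius. The induction splits [(M + d) ^+ k.+1] as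
    [M * (M + d) ^+ k + d * (M + d) ^+ k]. *)
Lemma pow_diff_le (y h : R) k : `|y| <= M -> `|h| <= d ->
  `|(y + h) ^+ k - y ^+ k| * d <= `|h| * (M + d) ^+ k.
Proof.
move=> yM hd; elim: k => [|k IHk]; first by rewrite subrr normr0 mul0r expr0 mulr1.
have -> : (y + h) ^+ k.+1 - y ^+ k.+1 =
    y * ((y + h) ^+ k - y ^+ k) + h * (y + h) ^+ k by rewrite !exprS; ring.
apply: (@le_trans _ _ (M * (`|h| * (M + d) ^+ k) + `|h| * (M + d) ^+ k * d)); last first.
  by rewrite exprS le_eqVlt; apply/orP; left; apply/eqP; ring.
apply: le_trans (ler_wpM2r d0 (ler_normD _ _)) _; rewrite mulrDl !normrM.
apply: lerD; first by rewrite -mulrA ler_pM // mulr_ge0.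
rewrite ler_wpM2r // ler_wpM2l // pow_le //.
by apply: le_trans (ler_normD _ _) _; exact: lerD.
Qed.

(** Same induction at second order; the extra term [h * ((y + h) ^+ k - y ^+ k)] is controlled by
    [pow_diff_le]. For [k = 0] the truncated exponent [k.-1] is harmless because of the factor
    [k%:R]. *)
Lemma pow_taylor_le (y h : R) k : `|y| <= M -> `|h| <= d ->
  `|(y + h) ^+ k - y ^+ k - h * (k%:R * y ^+ k.-1)| * d ^+ 2 <=
  h ^+ 2 * (M + d) ^+ k.
Proof.
move=> yM hd; elim: k => [|k IHk].
  by rewrite mul0r mulr0 subrr subr0 normr0 mul0r expr0 mulr1 sqr_ge0.
have -> : (y + h) ^+ k.+1 - y ^+ k.+1 - h * (k.+1%:R * y ^+ k) =
    y * ((y + h) ^+ k - y ^+ k - h * (k%:R * y ^+ k.-1)) +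
    h * ((y + h) ^+ k - y ^+ k).
  by case: k {IHk} => [|k]; rewrite ?exprS /= -?natr1 ?expr0 ?exprS; ring.
have h2 : h ^+ 2 = `|h| * `|h| by rewrite -expr2 real_normK // num_real.
apply: (@le_trans _ _ (M * (h ^+ 2 * (M + d) ^+ k) +
    `|h| * (`|h| * (M + d) ^+ k) * d)); last first.
  by rewrite [(M + d) ^+ k.+1]exprS h2 le_eqVlt; apply/orP; left; apply/eqP; ring.
apply: le_trans (ler_wpM2r (sqr_ge0 d) (ler_normD _ _)) _; rewrite mulrDl !normrM.
apply: lerD; first by rewrite -mulrA ler_pM // mulr_ge0 // sqr_ge0.
by rewrite expr2 [leLHS]mulrA ler_wpM2r // -mulrA ler_wpM2l // pow_diff_le.
Qed.

Lemma pow_deriv_le (y : R) k : `|y| <= M ->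
  `|k%:R * y ^+ k.-1| * d <= (M + d) ^+ k.
Proof.
move=> yM; have yMd : `|y| <= M + d by rewrite (le_trans yM) // lerDl.
elim: k => [|k IHk]; first by rewrite mul0r normr0 mul0r expr0 ler01.
have -> : k.+1%:R * y ^+ k = y * (k%:R * y ^+ k.-1) + y ^+ k.
  by case: k {IHk} => [|k]; rewrite -?natr1 ?expr0 /= ?exprS; ring.
apply: le_trans (ler_wpM2r d0 (ler_normD _ _)) _; rewrite mulrDl normrM.
rewrite [leRHS]exprS mulrDl lerD //; first by rewrite -mulrA ler_pM // mulr_ge0.
by rewrite mulrC ler_wpM2l // pow_le.
Qed.

End PowerDifferences.

(** Factors are replaced one at a time, each replacement costing at most [k] times the product of
    the bounds. *)
Lemma prod_diff_le (R : realType) (I : Type) (s : seq I) (u v M : I -> R) (k : R) :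
  0 <= k -> (forall i, `|u i| <= M i) -> (forall i, `|v i| <= M i) ->
  (forall i, `|u i - v i| <= k * M i) ->
  `|\prod_(i <- s) u i - \prod_(i <- s) v i| <= (size s)%:R * k * \prod_(i <- s) M i.
Proof.
move=> k0 uM vM uvM; have M0 i : 0 <= M i by exact: le_trans (uM i).
elim: s => [|i s IHs]; first by rewrite !big_nil subrr normr0 !mul0r.
rewrite !big_cons; set p := \prod_(_ <- _) u _; set q := \prod_(_ <- _) v _.
set m := \prod_(_ <- _) M _.
have m0 : 0 <= m by exact: prodr_ge0.
have qm : `|q| <= m by rewrite normr_prod ler_prod // => j _; rewrite normr_ge0 vM.
have -> : u i * p - v i * q = u i * (p - q) + (u i - v i) * q by ring.
apply: le_trans (ler_normD _ _) _; rewrite !normrM.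
apply: (@le_trans _ _ (M i * ((size s)%:R * k * m) + k * M i * m)).
  by apply: lerD; apply: ler_pM.
by rewrite /= -natr1 le_eqVlt; apply/orP; left; apply/eqP; ring.
Qed.

(** * Analytic functions on a polydisc: continuity and termwise differentiation *)

Section AnalyticOn.
Context {R : realType} {n : nat}.
Implicit Types (f g : 'rV[R]_n -> R) (x : 'rV[R]_n) (r : R).

Lemma exists_larger_polydisc r x : `|x| < r -> exists2 d, 0 < d & `|x| + d < r.
Proof. by move=> xr; exists ((r - `|x|) / 2); move: xr; lra. Qed.

Definition analytic_on r f := exists c : {ffun 'I_n -> nat} -> R,
  forall x, `|x| < r -> absum (powser_term c x) (f x).

Lemma analytic_germP f : analytic_germ f <-> exists2 r, 0 < r & analytic_on r f.
Proof.
split=> [[c [r [r0 cf]]]|[r r0 [c cf]]].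
  exists r => //; exists c => x xr; have [c1 c2] := cf x xr; split.
    by move: c1; under eq_fun do rewrite (sum_cubeE _ (fun a => `|powser_term c x a|)).
  by move: c2; under eq_fun do rewrite sum_cubeE.
exists c, r; split=> // x xr; have [c1 c2] := cf x xr; split.
  by under eq_fun do rewrite (sum_cubeE _ (fun a => `|powser_term c x a|)).
by under eq_fun do rewrite sum_cubeE.
Qed.

Lemma analytic_on_le r r' f : r' <= r -> analytic_on r f -> analytic_on r' f.
Proof. by move=> rr [c cf]; exists c => x xr; apply: cf; exact: lt_le_trans rr. Qed.

(* At the point (rho, ..., rho) the terms of the series are the largest ones on the
   polydisc of radius rho. *)
Lemma powser_bound r f (c : {ffun 'I_n -> nat} -> R) (rho : R) :
  (forall x, `|x| < r -> absum (powser_term c x) (f x)) -> 0 <= rho < r ->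
  exists C, forall N, \sum_(a <- cube n N) `|c a| * \prod_i rho ^+ a i <= C.
Proof.
move=> cf /andP[rho0 rhor].
have [|C CP] := @absum_bounded _ _ (powser_term c (const_mx rho)) (f (const_mx rho)).
  apply: cf; apply: le_lt_trans rhor.
  rewrite /Num.norm /= mx_normrE; apply: bigmax_le => // -[i j] _ /=.
  by rewrite mxE ger0_norm.
exists C => N; move: (CP N); apply: le_trans; apply: ler_sum => a _.
rewrite /powser_term normrM ler_wpM2l // normr_prod.
rewrite le_eqVlt; apply/orP; left; apply/eqP; apply: eq_bigr => i _.
by rewrite mxE normrX ger0_norm.
Qed.

(** A Lipschitz estimate at [x] follows term by term from [pow_diff_le] in each coordinate and
    [prod_diff_le]; the majorants are the terms of the series at radius [|x| + d]. *)
Lemma analytic_on_continuous r f x : analytic_on r f -> `|x| < r ->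
  {for x, continuous f}.
Proof.
move=> [c cf] xr; have [d d0 dr] := exists_larger_polydisc xr.
have [|C CP] := powser_bound (rho := `|x| + d) cf.
  by rewrite addr_ge0 ?(ltW d0).
have C0 : 0 <= C.
  apply: le_trans (CP 0%N); apply: sumr_ge0 => a _.
  by rewrite mulr_ge0 // prodr_ge0 // => i _; rewrite exprn_ge0 // addr_ge0 // ltW.
suff lip h : `|h| <= d -> `|f (h + x) - f x| <= `|h| * (n%:R / d * C).
  apply/(cvgrPdistC_le (F := nbhs x)) => e e0.
  (* The summand 1 makes [K] positive even if [n] or [C] is zero. *)
  pose K := n%:R / d * C + 1.
  have K0 : 0 < K by rewrite ltr_wpDl // mulr_ge0 // divr_ge0 // ltW.
  suff: \forall y \near x, `|f y - f x| <= e by [].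
  rewrite (near_shift 0 x) subr0.
  have h1 : \forall h \near (0 : 'rV[R]_n), `|h| <= d by exact: nbhs0_le.
  have h2 : \forall h \near (0 : 'rV[R]_n), `|h| <= e / K.
    by apply: nbhs0_le; rewrite divr_gt0.
  apply: filterS2 h1 h2 => h hd he /=.
  apply: le_trans (lip h hd) _.
  apply: (@le_trans _ _ (`|h| * K)); first by rewrite ler_wpM2l // lerDl.
  by rewrite -ler_pdivlMr.
move=> hd.
have xhr : `|h + x| < r.
  apply: le_lt_trans (ler_normD _ _) _; rewrite addrC.
  by apply: le_lt_trans dr; rewrite lerD2l.
have S := absumD (cf _ xhr) (absumZ (-1) (cf _ xr)); rewrite mulN1r in S.
apply: (absum_norm_le S) => N.
have -> : `|h| * (n%:R / d * C) = n%:R * (`|h| / d) * C by ring.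
apply: (@le_trans _ _ (n%:R * (`|h| / d) *
  \sum_(a <- cube n N) `|c a| * \prod_i (`|x| + d) ^+ a i)); last first.
  by rewrite ler_wpM2l // mulr_ge0 // divr_ge0 // ltW.
rewrite mulr_sumr; apply: ler_sum => a _.
rewrite mulN1r /powser_term -mulrBr normrM [leRHS]mulrCA ler_wpM2l //.
have := @prod_diff_le R _ (index_enum 'I_n) (fun i => (h + x) 0 i ^+ a i)
  (fun i => x 0 i ^+ a i) (fun i => (`|x| + d) ^+ a i) (`|h| / d).
have -> : size (index_enum 'I_n) = n by rewrite -sum1_size sum1_card card_ord.
have xi i : `|x 0 i| <= `|x| by exact: norm_rV_le.
have hi i : `|h 0 i| <= `|h| by exact: norm_rV_le.
apply.
- by rewrite divr_ge0 // ltW.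
- move=> i; rewrite mxE addrC; apply: pow_le; rewrite ?(ltW d0) //.
  apply: le_trans (ler_normD _ _) _; apply: lerD => //.
  exact: le_trans hd.
- by move=> i; apply: pow_le; rewrite ?(ltW d0) // (le_trans (xi i)) // lerDl ltW.
- move=> i; rewrite mxE [h 0 i + _]addrC mulrAC ler_pdivlMr //.
  apply: le_trans (pow_diff_le (ltW d0) (normr_ge0 _) (a i) (xi i) (le_trans (hi i) hd)) _ => //.
  by rewrite ler_wpM2r // exprn_ge0 // addr_ge0 // ltW.
Qed.

(** Exponent of the monomial $x_i x^a$; it describes multiplication by a coordinate and, read
    backwards, differentiation. *)
Definition mono_shift (i : 'I_n) (a : {ffun 'I_n -> nat}) : {ffun 'I_n -> nat} :=
  [ffun j => a j + (j == i)]%N.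

Lemma mono_shift_inj i : injective (mono_shift i).
Proof.
move=> a b /ffunP ab; apply/ffunP => j; have := ab j.
by rewrite !ffunE => /addIn.
Qed.

Lemma mono_shift_surj i (a : {ffun 'I_n -> nat}) : (0 < a i)%N ->
  exists b, a = mono_shift i b.
Proof.
move=> ai; exists [ffun j => a j - (j == i)]%N; apply/ffunP => j.
by rewrite !ffunE subnK //; case: eqVneq => // ->.
Qed.

(** These are the two compatibilities with cubes required by [absum_reindex]. *)
Lemma cube_mono_shift i N a :
  (mono_shift i a \in cube n N -> a \in cube n N) /\
  (a \in cube n N -> mono_shift i a \in cube n N.+1).
Proof.
rewrite !mem_cube; split=> /forallP aN; apply/forallP => j; have := aN j; rewrite ffunE.
  exact/leq_ltn_trans/leq_addr.
by move=> aj; case: (j == i); rewrite ?addn1 ?addn0 //; exact: leqW.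
Qed.

Lemma prod_mono_shift i (a : {ffun 'I_n -> nat}) (u : 'I_n -> R) :
  \prod_j u j ^+ mono_shift i a j = u i * \prod_j u j ^+ a j.
Proof.
under eq_bigr do rewrite ffunE exprD.
rewrite big_split /= mulrC; congr (_ * _).
rewrite (bigD1 i) //= eqxx expr1 big1 ?mulr1 // => j /negbTE ->.
by rewrite expr0.
Qed.

Definition dpowser (c : {ffun 'I_n -> nat} -> R) (i : 'I_n) (a : {ffun 'I_n -> nat}) : R :=
  (a i).+1%:R * c (mono_shift i a).

(** The derived terms are summable by [pow_deriv_le]. Summing the bound [pow_taylor_le] gives a
    remainder quadratic in [t], so the sum of the derived terms is the partial derivative, on the
    same polydisc. *)
Lemma analytic_on_derive r f c : (forall x, `|x| < r -> absum (powser_term c x) (f x)) ->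
  forall i x, `|x| < r -> derivable f x (delta_mx 0 i) /\
   absum (powser_term (dpowser c i) x) ('D_(delta_mx 0 i) f x).
Proof.
move=> cf i x xr; have [d d0 dr] := exists_larger_polydisc xr.
have [|C CP] := powser_bound (rho := `|x| + d) cf.
  by rewrite addr_ge0 ?(ltW d0).
have C0 : 0 <= C.
  apply: le_trans (CP 0%N); apply: sumr_ge0 => a _.
  by rewrite mulr_ge0 // prodr_ge0 // => j _; rewrite exprn_ge0 // addr_ge0 // ltW.
have xi j : `|x 0 j| <= `|x| by exact: norm_rV_le.
(* Derivatives of the terms, still indexed by the exponents in [f]; the shift to the exponents of
   [dpowser] is made at the end. *)
pose D (a : {ffun 'I_n -> nat}) :=
  c a * ((a i)%:R * x 0 i ^+ (a i).-1 * \prod_(j | j != i) x 0 j ^+ a j).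
have prod_le a : `|\prod_(j | j != i) x 0 j ^+ a j| <= \prod_(j | j != i) (`|x| + d) ^+ a j.
  rewrite normr_prod; apply: ler_prod => j _; rewrite normr_ge0 /=.
  by apply: pow_le; rewrite ?(ltW d0) // (le_trans (xi j)) // lerDl ltW.
have Dle a : `|D a| <= d^-1 * (`|c a| * \prod_j (`|x| + d) ^+ a j).
  rewrite mulrC ler_pdivlMr // /D normrM -(mulrA `|c a|) ler_wpM2l //.
  rewrite normrM mulrAC [leRHS](bigD1 i) //= ler_pM ?mulr_ge0 ?(ltW d0) //.
  by apply: pow_deriv_le => //; exact: ltW.
have DC N : \sum_(a <- cube n N) `|D a| <= d^-1 * C.
  apply: le_trans (ler_sum _ (fun a _ => Dle a)) _.
  by rewrite -mulr_sumr ler_wpM2l // invr_ge0 ltW.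
have [s Ds] : exists s, absum D s by exact: bounded_absum DC.
have taylor (t : R) : `|t| <= d ->
    `|f (t *: delta_mx 0 i + x) - f x - t * s| <= t ^+ 2 * (C / d ^+ 2).
  move=> td.
  have xtr : `|t *: delta_mx 0 i + x| < r.
    apply: le_lt_trans dr; rewrite addrC; apply: le_trans (ler_normD _ _) _.
    by rewrite lerD2l normrZ norm_delta_mx mulr1.
  have S := absumD (absumD (cf _ xtr) (absumZ (-1) (cf _ xr))) (absumZ (- t) Ds).
  rewrite mulN1r mulNr in S; apply: (absum_norm_le S) => N.
  apply: (@le_trans _ _ (t ^+ 2 / d ^+ 2 *
    \sum_(a <- cube n N) `|c a| * \prod_i (`|x| + d) ^+ a i)); last first.
    rewrite [leRHS](_ : _ = t ^+ 2 / d ^+ 2 * C); last by rewrite mulrA mulrAC.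
    by rewrite ler_wpM2l // divr_ge0 // sqr_ge0.
  rewrite mulr_sumr; apply: ler_sum => a _.
  have -> : powser_term c (t *: delta_mx 0 i + x) a + -1 * powser_term c x a + - t * D a =
    c a * (((x 0 i + t) ^+ a i - x 0 i ^+ a i - t * ((a i)%:R * x 0 i ^+ (a i).-1)) *
           \prod_(j | j != i) x 0 j ^+ a j).
    rewrite /powser_term /D (bigD1 i) //= [\prod_j x 0 j ^+ a j](bigD1 i) //=.
    rewrite !mxE !eqxx mulr1.
    have -> : \prod_(j | j != i) (t *: delta_mx 0 i + x) 0 j ^+ a j =
        \prod_(j | j != i) x 0 j ^+ a j.
      by apply: eq_bigr => j /negbTE ji; rewrite !mxE ji andbF mulr0 add0r.
    by rewrite [t + _]addrC; ring.
  rewrite normrM [leRHS]mulrCA ler_wpM2l // normrM [\prod_j (_ + _) ^+ _](bigD1 i) //= [leRHS]mulrA.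
  apply: ler_pM => //; rewrite [leRHS]mulrAC ler_pdivlMr ?exprn_gt0 //.
  by apply: pow_taylor_le => //; exact: ltW.
have df : is_derive x (delta_mx 0 i) f s.
  have lim : (fun h : R => h^-1 *: ((f \o shift x) (h *: delta_mx 0 i) - f x)) @ 0^' --> s.
    apply/cvgrPdistC_le => e e0.
    pose K := C / d ^+ 2 + 1.
    have K0 : 0 < K by rewrite ltr_wpDl // divr_ge0 // sqr_ge0.
    have h1 : \forall t \near (0 : R)^', `|t| <= d by exact: dnbhs0_le.
    have h2 : \forall t \near (0 : R)^', `|t| <= e / K.
      by apply: dnbhs0_le; rewrite divr_gt0.
    have h3 : \forall t \near (0 : R)^', t != 0 by exact: nbhs_dnbhs_neq.
    near=> t.
    have td : `|t| <= d by near: t.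
    have te : `|t| <= e / K by near: t.
    have t0 : t != 0 by near: t.
    have -> : t^-1 *: ((f \o shift x) (t *: delta_mx 0 i) - f x) - s =
        t^-1 * (f (t *: delta_mx 0 i + x) - f x - t * s).
      by rewrite mulrBr mulKf.
    rewrite normrM normfV ler_pdivrMl ?normr_gt0 //.
    apply: le_trans (taylor t td) _.
    rewrite -real_normK ?num_real // expr2 -mulrA ler_wpM2l //.
    apply: (@le_trans _ _ (`|t| * K)); first by rewrite ler_wpM2l // lerDl.
    by rewrite -ler_pdivlMr.
  split; first by apply/cvg_ex; exists s.
  exact/cvg_lim.
have [d1 ->] := df; split=> //.
have FD b : D (mono_shift i b) = powser_term (dpowser c i) x b.
  rewrite /D /powser_term /dpowser ffunE eqxx addn1 /=.
  rewrite [\prod_j x 0 j ^+ b j](bigD1 i) //=.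
  have -> : \prod_(j | j != i) x 0 j ^+ mono_shift i b j = \prod_(j | j != i) x 0 j ^+ b j.
    by apply: eq_bigr => j /negbTE ji; rewrite ffunE ji addn0.
  by ring.
(* [absum_reindex] goes from [dpowser] to [D], so summability of the former comes first; uniqueness
   of sums then identifies [t] with [s]. *)
have [t Dt] : exists t, absum (powser_term (dpowser c i) x) t.
  apply: (@bounded_absum _ _ _ (d^-1 * C)) => N; apply: le_trans (DC N.+1).
  under eq_bigr do rewrite -FD.
  rewrite -(big_map (mono_shift i) xpredT (fun a => `|D a|)).
  rewrite [leRHS](@sum_uniq_split _ _ (map (mono_shift i) (cube n N)))
    ?lerDl ?sumr_ge0 ?cube_uniq //.
    by rewrite map_inj_uniq ?cube_uniq //; exact: mono_shift_inj.
  by move=> a /mapP[b bN ->]; apply: (proj2 (cube_mono_shift i N b)).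
suff Dt' : absum D t by rewrite (absum_unique Ds Dt').
apply: absum_reindex (@mono_shift_inj i) FD _ _ _ Dt.
- move=> a; rewrite /D; have [->|ai _] := posnP (a i); last exact: mono_shift_surj.
  by rewrite !mul0r mulr0 eqxx.
- by move=> N b; have [] := cube_mono_shift i N b.
- by move=> N b; have [] := cube_mono_shift i N b.
Unshelve. all: by end_near. Qed.

End AnalyticOn.

(** * Stability properties of the classes of germs *)

Section Colsub.
Context {R : realType} {k n : nat}.
Variable s : 'I_k -> 'I_n.
Hypothesis s_inj : injective s.
Implicit Types (f : 'rV[R]_k -> R) (x : 'rV[R]_n).

Lemma colsub_norm_le x : `|colsub s x| <= `|x|.
Proof.
rewrite [leLHS]/Num.norm /= mx_normrE; apply: bigmax_le => // -[i j] _ /=.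
by rewrite mxE (ord1 i) norm_rV_le.
Qed.

Lemma colsub_delta (j : 'I_k) :
  colsub s (delta_mx 0 (s j)) = delta_mx 0 j :> 'rV[R]_k.
Proof. by apply/rowP => l; rewrite !mxE eqxx (inj_eq s_inj). Qed.

Lemma colsub_delta0 (i : 'I_n) : (forall j, s j != i) ->
  colsub s (delta_mx 0 i) = 0 :> 'rV[R]_k.
Proof. by move=> si; apply/rowP => l; rewrite !mxE eqxx (negbTE (si l)). Qed.

Lemma colsub_continuous : continuous (colsub s : 'rV[R]_n -> 'rV[R]_k).
Proof.
move=> x; apply/(cvgrPdistC_le (F := nbhs x)) => e e0.
suff: \forall y \near x, `|colsub s y - colsub s x| <= e by [].
rewrite (near_shift 0 x) subr0.
have : \forall h \near (0 : 'rV[R]_n), `|h| <= e by exact: nbhs0_le.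
apply: filterS => h he /=; rewrite linearD /= addrK.
exact: le_trans (colsub_norm_le h) he.
Qed.

Lemma growth_rate_colsub f x (v : 'rV[R]_n) :
  (fun h : R => h^-1 *: (((f \o colsub s) \o shift x) (h *: v) - (f \o colsub s) x)) =
  (fun h : R => h^-1 *: ((f \o shift (colsub s x)) (h *: colsub s v) - f (colsub s x))).
Proof.
apply/funext => h /=.
have -> : colsub s (h *: v + x) = h *: colsub s v + colsub s x.
  by apply/rowP => j; rewrite !mxE.
by [].
Qed.

Lemma derivable_colsub f x (v : 'rV[R]_n) :
  derivable f (colsub s x) (colsub s v) -> derivable (f \o colsub s) x v.
Proof. by rewrite /derivable growth_rate_colsub. Qed.

Lemma derive_colsub f x (v : 'rV[R]_n) :
  'D_v (f \o colsub s) x = 'D_(colsub s v) f (colsub s x).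
Proof. by rewrite /derive growth_rate_colsub. Qed.

(** Along a coordinate selected by [s] the derivative falls on [f]; along any other coordinate the
    composite is constant. *)
Lemma Ck_on_colsub (U : set 'rV[R]_k) m f :
  Ck_on U m f -> Ck_on (colsub s @^-1` U) m (f \o colsub s).
Proof.
elim: m f => [|m IHm] f cf.
  move=> x Ux; apply: continuous_comp; first exact: colsub_continuous.
  exact: cf.
move=> i; have [[j ij]|ni] := pselect (exists j, s j = i).
  have [df Df] := cf j; split=> [x Ux|].
    by apply: derivable_colsub; rewrite -ij colsub_delta; exact: df.
  have -> : (fun x => 'D_(delta_mx 0 i) (f \o colsub s) x) =
      (fun y => 'D_(delta_mx 0 j) f y) \o (colsub s : 'rV[R]_n -> 'rV[R]_k).
    by apply/funext => x; rewrite derive_colsub -ij colsub_delta.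
  exact: IHm.
have e0 : colsub s (delta_mx 0 i) = 0 :> 'rV[R]_k.
  by apply: colsub_delta0 => j; apply/eqP => ji; apply: ni; exists j.
split=> [x Ux|].
  by apply: derivable_colsub; rewrite e0; exact: derivable0.
have -> : (fun x => 'D_(delta_mx 0 i) (f \o colsub s) x) = (fun=> 0).
  by apply/funext => x; rewrite derive_colsub e0 derive0.
exact: Ck_on_cst.
Qed.

Let p (b : {ffun 'I_k -> nat}) : {ffun 'I_n -> nat} :=
  [ffun i => \sum_(j | s j == i) b j]%N.

Let pE b j : p b (s j) = b j.
Proof. by rewrite ffunE (big_pred1 j) // => l; rewrite /= (inj_eq s_inj). Qed.

Lemma analytic_on_colsub r f :
  analytic_on r f -> analytic_on r (f \o colsub s).
Proof.
move=> [c cf]; pose q (a : {ffun 'I_n -> nat}) := [ffun j => a (s j)].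
have qp b : q (p b) = b by apply/ffunP => j; rewrite ffunE pE.
(* [p] extends a multi-index by zero outside the image of [s] and [q] restricts along [s]; the test
   says that [a] is supported on that image. *)
exists (fun a => if p (q a) == a then c (q a) else 0) => x xr.
have := cf (colsub s x) (le_lt_trans (colsub_norm_le x) xr).
apply: (absum_reindex (p := p)).
- by move=> a b /(congr1 q); rewrite !qp.
- move=> b; rewrite /powser_term qp eqxx; congr (_ * _).
  under eq_bigr do rewrite ffunE expr_sum.
  rewrite [RHS](partition_big s xpredT) //=; apply: eq_bigr => i _.
  by apply: eq_bigr => j /eqP <-; rewrite mxE.
- move=> a; rewrite /powser_term; case: (p (q a) =P a) => [E _|_]; last by rewrite mul0r eqxx.
  by exists (q a).
- move=> N b; rewrite !mem_cube => /forallP bN; apply/forallP => j.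
  by rewrite -pE.
- move=> N b; rewrite !mem_cube => /forallP bN; apply/forallP => i.
  have [[j <-]|ni] := pselect (exists j, s j = i); first by rewrite pE leqW.
  rewrite ffunE big_pred0 // => j; apply/eqP => ij; apply: ni; by exists j.
Qed.

End Colsub.

Section AnalyticOps.
Context {R : realType} {n : nat}.
Implicit Types (f g : 'rV[R]_n -> R) (x : 'rV[R]_n) (r : R).

Lemma absum_single (F : {ffun 'I_n -> nat} -> R) a0 :
  (forall a, a != a0 -> F a = 0) -> absum F (F a0).
Proof.
move=> F0.
have FE (H : R -> R) N : H 0 = 0 -> a0 \in cube n N -> \sum_(a <- cube n N) H (F a) = H (F a0).
  move=> H0 aN; rewrite (bigD1_seq a0) ?cube_uniq //= big1 ?addr0 // => a aa0.
  by rewrite F0.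
have inN : \forall N \near \oo, a0 \in cube n N.
  exists (\max_i a0 i).+1 => // N /= maxN; rewrite mem_cube; apply/forallP => i.
  by apply: leq_trans maxN; rewrite ltnS; exact: leq_bigmax.
split.
  apply: (@cvgn_sum_cube _ _ _ `|F a0|) => // N.
  have [aN|aN] := boolP (a0 \in cube n N); first by rewrite (FE Num.norm) ?normr0.
  rewrite big_seq big1 // => a aN'; rewrite F0 ?normr0 //.
  by apply: contraNneq aN => <-.
apply: cvg_near_cst; apply: filterS inN => N aN.
by rewrite (FE id).
Qed.

Lemma analytic_on_cst r (k : R) : analytic_on r (fun _ : 'rV[R]_n => k).
Proof.
exists (fun a : {ffun 'I_n -> nat} => if a == [ffun=> 0%N] then k else 0) => x _.
have := @absum_single (powser_term
  (fun a : {ffun 'I_n -> nat} => if a == [ffun=> 0%N] then k else 0) x) [ffun=> 0%N].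
rewrite {3}/powser_term eqxx big1 ?mulr1; last by move=> i _; rewrite ffunE.
by apply=> a /negbTE a0; rewrite /powser_term a0 mul0r.
Qed.

Lemma analytic_onD r f g : analytic_on r f -> analytic_on r g ->
  analytic_on r (fun x => f x + g x).
Proof.
move=> [c cf] [d dg]; exists (fun a => c a + d a) => x xr.
have -> : powser_term (fun a => c a + d a) x =
   (fun a => powser_term c x a + powser_term d x a).
  by apply/funext => a; rewrite /powser_term mulrDl.
by apply: absumD; [exact: cf|exact: dg].
Qed.

Lemma analytic_onZ r k f : analytic_on r f -> analytic_on r (fun x => k * f x).
Proof.
move=> [c cf]; exists (fun a => k * c a) => x xr.
have -> : powser_term (fun a => k * c a) x = (fun a => k * powser_term c x a).
  by apply/funext => a; rewrite /powser_term mulrA.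
by apply: absumZ; exact: cf.
Qed.

Lemma analytic_on_coordM r (i : 'I_n) f : analytic_on r f ->
  analytic_on r (fun x => x 0 i * f x).
Proof.
move=> [c cf].
pose d (a : {ffun 'I_n -> nat}) : R :=
  if a i == 0%N then 0 else c [ffun j => a j - (j == i)]%N.
exists d => x xr.
apply: absum_reindex (@mono_shift_inj n i) _ _ _ _ (absumZ (x 0 i) (cf x xr)).
- move=> b; rewrite /powser_term prod_mono_shift [RHS]mulrCA; congr (_ * _).
  rewrite /d ffunE eqxx addn1 /=; congr c; apply/ffunP => j.
  by rewrite !ffunE addnK.
- move=> a; rewrite /powser_term /d; case: posnP => [|ai _].
    by rewrite mul0r eqxx.
  exact: mono_shift_surj.
- by move=> N b; have [] := cube_mono_shift i N b.
- by move=> N b; have [] := cube_mono_shift i N b.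
Qed.

Lemma analytic_on_partial r f (i : 'I_n) : analytic_on r f ->
  analytic_on r (fun x => 'D_(delta_mx 0 i) f x).
Proof.
move=> [c cf]; exists (dpowser c i) => x xr.
by have [] := analytic_on_derive cf i xr.
Qed.

Lemma analytic_on_Ck r f m : analytic_on r f -> Ck_on [set x | `|x| < r] m f.
Proof.
elim: m f => [|m IHm] f af /=.
  by move=> x /= xr; exact: analytic_on_continuous af xr.
move=> i; split; last exact/IHm/analytic_on_partial.
by move=> x /= xr; have [c cf] := af; have [] := analytic_on_derive cf i xr.
Qed.

Lemma open_norm_lt r : open [set x : 'rV[R]_n | `|x| < r].
Proof.
apply: (open_comp (f := fun x : 'rV[R]_n => `|x|) (D := [set y | y < r])).
  by move=> x _; exact: norm_continuous.
exact: open_lt.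
Qed.

End AnalyticOps.

Section OfClass.
Context {R : realType} (cat : category).

(** Lets differentiability arguments treat both categories at once. *)
Lemma of_class_smooth n (f : 'rV[R]_n -> R) : of_class cat f -> smooth_germ f.
Proof.
case: cat => //= /analytic_germP[r r0 af].
exists [set x | `|x| < r]; split; [exact: open_norm_lt|by rewrite /= normr0|].
by move=> k; exact: analytic_on_Ck.
Qed.

Lemma of_class_near_eq n (f g : 'rV[R]_n -> R) :
  (\forall x \near (0 : 'rV[R]_n), f x = g x) -> of_class cat f -> of_class cat g.
Proof.
move=> /nbhs_ballP[r /= r0 rP].
have {}rP x : `|x| < r -> f x = g x.
  by move=> xr; apply: rP; rewrite -ball_normE /= sub0r normrN.
case: cat => /=.
  move=> [U [oU U0 cU]]; exists (U `&` [set x | `|x| < r]).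
  have oU' : open (U `&` [set x | `|x| < r]) by apply: openI => //; exact: open_norm_lt.
  split=> // [|k]; first by split=> //=; rewrite normr0.
  apply: (Ck_on_eq oU' (f := f)); first by move=> x [_ /= xr]; exact: rP.
  by apply: Ck_on_sub (cU k) => x [].
move=> /analytic_germP[r' r'0 [c cf]]; apply/analytic_germP.
exists (Num.min r' r); first by rewrite lt_min r'0.
exists c => x; rewrite lt_min => /andP[xr' xr].
by rewrite -rP //; exact: cf.
Qed.

Lemma of_class_cst n (k : R) : of_class cat (fun _ : 'rV[R]_n => k).
Proof.
case: cat => /=; first by exists setT; split=> //; [exact: openT|move=> m; exact: Ck_on_cst].
by apply/analytic_germP; exists 1 => //; exact: analytic_on_cst.
Qed.

Lemma of_classD n (f g : 'rV[R]_n -> R) : of_class cat f -> of_class cat g ->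
  of_class cat (fun x => f x + g x).
Proof.
case: cat => /=.
  move=> [U [oU U0 cU]] [V [oV V0 cV]]; exists (U `&` V); split=> // [|k].
    exact: openI.
  apply: Ck_onD; first exact: openI.
    by apply: Ck_on_sub (cU k) => x [].
  by apply: Ck_on_sub (cV k) => x [].
move=> /analytic_germP[r r0 af] /analytic_germP[r' r'0 ag]; apply/analytic_germP.
exists (Num.min r' r); first by rewrite lt_min r'0.
apply: analytic_onD; [apply: analytic_on_le af|apply: analytic_on_le ag];
  by rewrite ge_min lexx ?orbT.
Qed.

Lemma of_classZ n k (f : 'rV[R]_n -> R) : of_class cat f ->
  of_class cat (fun x => k * f x).
Proof.
case: cat => /=.
  move=> [U [oU U0 cU]]; exists U; split=> // m.
  by apply: Ck_onM => //; exact: Ck_on_cst.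
move=> /analytic_germP[r r0 af]; apply/analytic_germP.
by exists r => //; exact: analytic_onZ.
Qed.

Lemma of_class_coordM n (i : 'I_n) (f : 'rV[R]_n -> R) : of_class cat f ->
  of_class cat (fun x => x 0 i * f x).
Proof.
case: cat => /=.
  move=> [U [oU U0 cU]]; exists U; split=> // m.
  by apply: Ck_onM => //; exact: Ck_on_coord.
move=> /analytic_germP[r r0 af]; apply/analytic_germP.
by exists r => //; exact: analytic_on_coordM.
Qed.

Lemma of_class_coordXM n (i : 'I_n) m (f : 'rV[R]_n -> R) : of_class cat f ->
  of_class cat (fun x => x 0 i ^+ m * f x).
Proof.
elim: m f => [|m IHm] f cf; first by under eq_fun do rewrite mul1r.
by under eq_fun do rewrite exprSr -mulrA; apply/IHm/of_class_coordM.
Qed.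

Lemma of_class_coordX n (i : 'I_n) m : of_class cat (fun x : 'rV[R]_n => x 0 i ^+ m).
Proof.
under eq_fun do rewrite -[_ ^+ _]mulr1.
exact/of_class_coordXM/of_class_cst.
Qed.

Lemma of_class_partial n (i : 'I_n) (f : 'rV[R]_n -> R) : of_class cat f ->
  of_class cat (fun x => 'D_(delta_mx 0 i) f x).
Proof.
case: cat => /=.
  move=> [U [oU U0 cU]]; exists U; split=> // m.
  by have [_] := cU m.+1 i.
move=> /analytic_germP[r r0 af]; apply/analytic_germP.
by exists r => //; exact: analytic_on_partial.
Qed.

Lemma of_class_colsub n k (s : 'I_k -> 'I_n) (f : 'rV[R]_k -> R) : injective s ->
  of_class cat f -> of_class cat (f \o colsub s).
Proof.
move=> sI; case: cat => /=.
  move=> [U [oU U0 cU]]; exists (colsub s @^-1` U); split=> [| |m].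
  - by apply: open_comp => // x _; exact: colsub_continuous.
  - by rewrite /= linear0.
  - exact: Ck_on_colsub.
move=> /analytic_germP[r r0 af]; apply/analytic_germP.
by exists r => //; exact: analytic_on_colsub.
Qed.

Lemma of_class_sum n (I : Type) (s : seq I) (F : I -> 'rV[R]_n -> R) :
  (forall i, of_class cat (F i)) -> of_class cat (fun x => \sum_(i <- s) F i x).
Proof.
move=> cF; elim: s => [|i s IHs].
  by under eq_fun do rewrite big_nil; exact: of_class_cst.
by under eq_fun do rewrite big_cons; exact: of_classD.
Qed.

End OfClass.

(** * Poisson brackets and the defining equation of a hypersurface *)

Section TangentVanish.
Context {R : realType} {n : nat}.
Implicit Types (h k : 'rV[R]_n -> R) (x v e : 'rV[R]_n).

(* By the intermediate value theorem, the zero set of [h] contains points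
   [x + t v + s e] with [s = o(t)]. *)
Lemma diff_eq0_of_zero_set h k x v e :
  (\forall y \near x, differentiable h y) -> h x = 0 ->
  'd h x e != 0 -> 'd h x v = 0 -> differentiable k x ->
  (\forall y \near x, h y = 0 -> k y = 0) -> 'd k x v = 0.
Proof.
move=> dh hx0 ce vker dk hk.
have kx0 : k x = 0 by exact: (nbhs_singleton hk).
have dhx : differentiable h x by exact: nbhs_singleton dh.
set c := 'd h x e in ce; pose M := `|v| + `|e| + 1.
have M0 : 0 < M by rewrite ltr_wpDl // addr_ge0.
(* Constant of the final estimate: [t * dk(v) + s * dk(e)] is at most [ep * t * M] in absolute
   value, while [s] is at most [ep * t]. *)
pose K := M + `|'d k x e|.
have K0 : 0 < K by rewrite ltr_wpDr.
suff main ep : 0 < ep -> ep <= 1 -> `|'d k x v| <= ep * K.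
  apply/eqP; rewrite -normr_le0; apply/ler_addgt0Pr => ep ep0; rewrite add0r.
  have [le1|gt1] := leP (ep / K) 1.
    apply: le_trans (main (ep / K) _ le1) _; first by rewrite divr_gt0.
    by rewrite divfK // gt_eqF.
  apply: le_trans (main 1 ltr01 (lexx _)) _; rewrite mul1r.
  by move: gt1; rewrite ltr_pdivlMr // mul1r => /ltW.
move=> ep0 ep1.
(* Makes the error of the linear approximation of [h] at [w s], at most [eta * (t * M)], half of
   [ep * t * |c|]. *)
pose eta := ep * `|c| / (2 * M).
have eta0 : 0 < eta by rewrite divr_gt0 ?mulr_gt0 ?normr_gt0.
have happ := differentiable_approx dhx eta0.
have kapp := differentiable_approx dk ep0.
have : \forall y \near x, differentiable h y /\ (h y = 0 -> k y = 0) by exact: filterI.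
rewrite (near_shift 0 x) subr0 => near_x.
have : \forall w \near (0 : 'rV[R]_n),
  [/\ `|h (w + x) - h x - 'd h x w| <= eta * `|w|,
      `|k (w + x) - k x - 'd k x w| <= ep * `|w| &
      differentiable h (w + x) /\ (h (w + x) = 0 -> k (w + x) = 0)].
  by apply: filterS3 happ kapp near_x.
move=> /nbhs_ballP[r /= r0 rP].
have [t t0 tM] : exists2 t, 0 < t & t * M < r.
  exists (r / (2 * M)); first by rewrite divr_gt0 // mulr_gt0.
  by rewrite invfM mulrA mulfVK ?gt_eqF // ltr_pdivrMr // ltr_pMr // ltr1n.
pose w (s : R) := t *: v + s *: e.
have wle s : `|s| <= ep * t -> `|w s| <= t * M.
  move=> st; apply: le_trans (ler_normD _ _) _; rewrite !normrZ (gtr0_norm t0).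
  have st' : `|s| <= t by apply: le_trans st _; rewrite ler_piMl // ltW.
  have : `|s| * `|e| <= t * `|e| by rewrite ler_wpM2r.
  by rewrite /M !mulrDr mulr1; move: t0; lra.
have good s : `|s| <= ep * t ->
  [/\ `|h (w s + x) - h x - 'd h x (w s)| <= eta * `|w s|,
      `|k (w s + x) - k x - 'd k x (w s)| <= ep * `|w s| &
      differentiable h (w s + x) /\ (h (w s + x) = 0 -> k (w s + x) = 0)].
  move=> st; apply: rP; rewrite -ball_normE /= sub0r normrN.
  exact: le_lt_trans (wle s st) tM.
have dhw s : 'd h x (w s) = s * c by rewrite linearD !linearZ /= vker scaler0 add0r.
have ept0 : 0 < ep * t by rewrite mulr_gt0.
(* At both ends [s = ep * t] and [s = - (ep * t)] the linear part [s * c] dominates, so [h] takes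
   opposite signs there and vanishes in between. *)
have hsign s : `|s| = ep * t -> `|h (w s + x) - s * c| < `|s * c|.
  move=> st; have [|+ _ _] := good s; first by rewrite st.
  rewrite hx0 subr0 dhw => /le_lt_trans; apply.
  apply: (@le_lt_trans _ _ (eta * (t * M))).
    by rewrite ler_wpM2l // ?(ltW eta0) // wle // st.
  rewrite normrM st /eta.
  have -> : ep * `|c| / (2 * M) * (t * M) = ep * t * `|c| / 2.
    by field; rewrite gt_eqF.
  by rewrite ltr_pdivrMr // ltr_pMr ?ltr1n // mulr_gt0 // normr_gt0.
have hcont : {within `[- (ep * t), ep * t], continuous (fun s => h (w s + x))}.
  apply: derivable_within_continuous => s; rewrite in_itv /= -ler_norml => st.
  have [_ _ [dhs _]] := good s st.
  suff dw : differentiable (fun s => w s + x) s.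
    apply/derivable1_diffP.
    exact: (@differentiable_comp _ _ _ _ (fun s => w s + x) h).
  have d1 : differentiable (fun s : R => s *: e) s by exact: differentiableZl.
  have d2 := differentiableD (differentiable_cst (t *: v) s) d1.
  exact: (differentiableD d2 (differentiable_cst x s)).
have [||s] := @IVT R (fun s => h (w s + x)) (- (ep * t)) (ep * t) 0 _ hcont.
- by move: ept0; lra.
- have := hsign (ep * t); rewrite gtr0_norm // => /(_ erefl).
  have := hsign (- (ep * t)); rewrite normrN gtr0_norm // => /(_ erefl).
  rewrite mulNr normrN opprK ge_min le_max.
  move: (h (w (- _) + x)) (h (w (ep * t) + x)) (ep * t * c) => a b d.
  rewrite !ltr_norml => /andP[h1 h2] /andP[h3 h4].
  have [d0|d0] := leP 0 d; move: h1 h2 h3 h4.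
    rewrite ger0_norm // => h1 h2 h3 h4.
    by apply/andP; split; apply/orP; [left|right]; lra.
  rewrite ltr0_norm // => h1 h2 h3 h4.
  by apply/andP; split; apply/orP; [right|left]; lra.
rewrite in_itv /= -ler_norml => st hs0.
have [_ kle [_ /(_ hs0) ks0]] := good s st.
move: kle; rewrite ks0 kx0 subr0 sub0r normrN linearD !linearZ /= => kle.
rewrite -(ler_pM2l t0) -{1}(gtr0_norm t0) -normrM.
have -> : t * 'd k x v = (t * 'd k x v + s * 'd k x e) - s * 'd k x e by rewrite addrK.
apply: le_trans (ler_normB _ _) _.
apply: (@le_trans _ _ (ep * (t * M) + ep * t * `|'d k x e|)).
  apply: lerD; last by rewrite normrM ler_wpM2r.
  by apply: le_trans kle _; rewrite ler_wpM2l ?wle // ltW.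
by rewrite /K le_eqVlt; apply/orP; left; apply/eqP; ring.
Qed.

(** The combination [dh(e) w - dh(w) e] lies in the kernel of [dh], hence in that of [dh']. *)
Lemma diff_proportional h h' x w e :
  (\forall y \near x, differentiable h y) -> h x = 0 ->
  'd h x e != 0 -> differentiable h' x ->
  (\forall y \near x, h y = 0 -> h' y = 0) ->
  'd h' x w * 'd h x e = 'd h' x e * 'd h x w.
Proof.
move=> dh hx0 ce dh' hh'.
pose v := 'd h x e *: w - 'd h x w *: e.
have dv k : 'd k x v = 'd h x e * 'd k x w - 'd h x w * 'd k x e.
  by rewrite linearB !linearZ.
have := @diff_eq0_of_zero_set h h' x v e dh hx0 ce _ dh' hh'.
rewrite !dv mulrC subrr => /(_ erefl) /eqP.
by rewrite subr_eq0 => /eqP; rewrite mulrC [RHS]mulrC.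
Qed.

End TangentVanish.

Lemma diff_minor (R : realType) (V : normedModType R) (a b c d : V -> R) (x v : V) :
  differentiable a x -> differentiable b x -> differentiable c x -> differentiable d x ->
  differentiable (fun y => a y * b y - c y * d y) x /\
  'd (fun y => a y * b y - c y * d y) x v =
    a x * 'd b x v + b x * 'd a x v - (c x * 'd d x v + d x * 'd c x v).
Proof.
move=> da db dc dd; have dab := differentiableM da db; have dcd := differentiableM dc dd.
have dm : differentiable (fun y => a y * b y - c y * d y) x by exact: (differentiableB dab dcd).
split=> //.
have [ma mb mc md] : [/\ derivable a x v, derivable b x v, derivable c x v & derivable d x v].
  by split; exact: diff_derivable.
apply: (etrans (esym (deriveE v dm))).
apply: (etrans (deriveB (derivableM ma mb) (derivableM mc md))); congr (_ - _).
  by apply: (etrans (deriveM ma mb)); rewrite (deriveE v da) (deriveE v db).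
by apply: (etrans (deriveM mc md)); rewrite (deriveE v dc) (deriveE v dd).
Qed.

(** * Hamiltonian fields, their regularity, and the change of defining equation *)

Section PoissonCalculus.
Context {R : realType} {n : nat}.
Implicit Types (f g h : 'rV[R]_n -> R) (x v w : 'rV[R]_n) (omega : two_form R n).

Lemma dform_val f x i : dform f x 0 i = 'd f x (delta_mx 0 i).
Proof. by rewrite mxE. Qed.

Lemma poissonE omega f h x : poisson omega f h x =
  \sum_i hamvf omega f x 0 i * dform h x 0 i.
Proof. by rewrite /poisson diff_dform. Qed.

Lemma poisson_mulmx omega f h x : poisson omega f h x =
  (hamvf omega f x *m (dform h x)^T) 0 0.
Proof. by rewrite poissonE mxE; apply: eq_bigr => i _; rewrite [_^T _ _]mxE. Qed.

(** This number is [omega(Z, Z)] for [Z = Z_h], a 1 by 1 skew matrix. It supplies the tangency of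
    [Z_h] to the hypersurface. *)
Lemma hamvf_skew omega h x : (omega x)^T = - omega x -> omega x \in unitmx ->
  'd h x (hamvf omega h x) = 0.
Proof.
move=> sk un; set Z := hamvf omega h x.
have ZE : Z *m omega x = dform h x by apply/hamvfP.
clearbody Z.
have : 'd h x Z = (Z *m omega x *m Z^T) 0 0.
  rewrite diff_dform [RHS]mxE ZE; apply: eq_bigr => i _.
  by rewrite mulrC; congr (_ * _); rewrite [RHS]mxE.
have MT : (Z *m omega x *m Z^T)^T = - (Z *m omega x *m Z^T).
  by rewrite !trmx_mul trmxK sk mulNmx mulmxN mulmxA.
have ME : (Z *m omega x *m Z^T) 0 0 = - (Z *m omega x *m Z^T) 0 0.
  move: (Z *m omega x *m Z^T) MT => M MT; have := congr1 (fun N : 'M[R]_1 => N 0 0) MT.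
  by rewrite /= !mxE.
move=> ->; apply/eqP; move/eqP: ME; rewrite -subr_eq0 opprK -mulr2n.
by rewrite mulrn_eq0.
Qed.

Lemma differentiable_det k (A : 'rV[R]_n -> 'M[R]_k) x :
  (forall i j, differentiable (fun y => A y i j) x) ->
  differentiable (fun y => \det (A y)) x.
Proof.
move=> dA; apply: differentiable_sumf => s _.
apply: (differentiableM (differentiable_cst _ _)).
by apply: differentiable_prodf => i _; exact: dA.
Qed.

(** Near [x] the entries of the inverse are cofactors divided by the determinant. *)
Lemma differentiable_invmx omega x :
  (\forall y \near x, omega y \in unitmx) ->
  (forall i j, differentiable (fun y => omega y i j) x) ->
  forall i j, differentiable (fun y => invmx (omega y) i j) x.
Proof.
move=> un dom i j.
have dinv : differentiable (fun y => (\det (omega y))^-1 * cofactor (omega y) j i) x.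
  apply: differentiableM.
    apply: differentiableV; first exact: differentiable_det.
    by have := nbhs_singleton un; rewrite unitmxE unitfE.
  have dd : differentiable (fun y => \det (row' j (col' i (omega y)))) x.
    apply: differentiable_det => a b.
    by under eq_fun do rewrite !mxE; exact: dom.
  exact: (differentiableM (differentiable_cst ((-1) ^+ (j + i) : R) x) dd).
apply: near_eq_differentiable dinv; apply: filterS un => y uy.
by rewrite /invmx uy !mxE.
Qed.

(** The regularity that a double bracket needs at one point: [{f,h}] contains first derivatives,
    which must again be differentiable at [x]. It passes to composites by the chain rule alone. *)
Definition twice_diff x f :=
  (\forall y \near x, differentiable f y) /\
  forall i, differentiable (fun y => dform f y 0 i) x.

Lemma twice_diff_continuous_dform x f i : twice_diff x f ->
  {for x, continuous (fun y => dform f y 0 i)}.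
Proof. by move=> [_ d]; exact/differentiable_continuous/d. Qed.

Lemma smooth_twice_diff f : smooth_germ f -> twice_diff 0 f.
Proof.
move=> [U [oU U0 cU]]; have nU := near_open oU U0; split.
  by apply: filterS nU => y Uy; exact: Ck_on1_differentiable (cU 1%N) Uy.
move=> i; have [_ c2] := cU 2%N i.
apply: near_eq_differentiable (Ck_on1_differentiable oU c2 U0).
apply: filterS nU => y Uy; rewrite dformE //.
exact: Ck_on1_differentiable (cU 1%N) Uy.
Qed.

Lemma differentiable_hamvf omega f x :
  (\forall y \near x, omega y \in unitmx) ->
  (forall i j, differentiable (fun y => omega y i j) x) ->
  twice_diff x f -> forall i, differentiable (fun y => hamvf omega f y 0 i) x.
Proof.
move=> un dom [_ df] i; under eq_fun do rewrite mxE.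
apply: differentiable_sumf => j _; apply: differentiableM; first exact: df.
exact: differentiable_invmx.
Qed.

Lemma differentiable_poisson omega f h x :
  (\forall y \near x, omega y \in unitmx) ->
  (forall i j, differentiable (fun y => omega y i j) x) ->
  twice_diff x f -> twice_diff x h -> differentiable (poisson omega f h) x.
Proof.
move=> un dom tf [_ dh].
have -> : poisson omega f h = (fun y => \sum_i hamvf omega f y 0 i * dform h y 0 i).
  by apply/funext => y; rewrite poissonE.
apply: differentiable_sumf => j _; apply: differentiableM; last exact: dh.
exact: differentiable_hamvf.
Qed.

(** Proportionality of the differentials is used at every point of the hypersurface near [x], each
    with its own neighbourhood. *)
Lemma near_near (P : 'rV[R]_n -> Prop) x :
  (\forall y \near x, P y) -> \forall y \near x, \forall z \near y, P z.
Proof. by move=> Px; exact: nbhs_interior. Qed.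

Section ChangeOfEquation.
Variables (omega : two_form R n) (f h h' : 'rV[R]_n -> R) (x : 'rV[R]_n).
Hypotheses (un : \forall y \near x, omega y \in unitmx)
  (sk : (omega x)^T = - omega x)
  (dom : forall i j, differentiable (fun y => omega y i j) x)
  (tf : twice_diff x f) (th : twice_diff x h) (th' : twice_diff x h')
  (h0 : h x = 0) (dh0 : dform h x != 0) (dh'0 : dform h' x != 0)
  (hh' : \forall y \near x, h y = 0 <-> h' y = 0)
  (fh0 : poisson omega f h x = 0).

(* On the hypersurface [dh'] is proportional to [dh], so
   [{f,h'} dh(e) - dh'(e) {f,h}] vanishes there; its differential at [x] therefore
   vanishes on tangent vectors. *)
Lemma poisson_change_equation : exists2 u, u != 0 &
  poisson omega f h' x = 0 /\
  poisson omega f (poisson omega f h') x = u * poisson omega f (poisson omega f h) x /\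
  poisson omega h' (poisson omega f h') x = u ^+ 2 * poisson omega h (poisson omega f h) x.
Proof.
(* The coordinate vector of index [i] serves as the transversal direction [e], the same at all
   nearby points. *)
have [i ei] : exists i, dform h x 0 i != 0.
  by case/rV0Pn: dh0 => i; exists i.
have hh1 : \forall y \near x, h y = 0 -> h' y = 0 by apply: filterS hh' => y [].
have [dh _] := th; have [dh' _] := th'.
have dhx := nbhs_singleton dh; have dh'x := nbhs_singleton dh'.
have nei : 'd h x (delta_mx 0 i) != 0 by move: ei; rewrite dform_val.
have nz : \forall y \near x, dform h y 0 i != 0.
  have c := twice_diff_continuous_dform (i := i) th.
  exact: (@cvgr_neq0 R R _ (nbhs x) _ (fun y => dform h y 0 i) (dform h x 0 i) c ei).
(* This is [diff_proportional] at [y], with [w] the Hamiltonian vector of [f] at [y]. *)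
have prop : \forall y \near x, h y = 0 ->
    poisson omega f h' y * dform h y 0 i = dform h' y 0 i * poisson omega f h y.
  have dd : \forall y \near x, (\forall z \near y, differentiable h z) /\ differentiable h' y.
    by apply: filterI => //; exact: near_near.
  have hhn := near_near hh1.
  apply: filterS3 nz dd hhn => y; rewrite !dform_val.
  by move=> ny [dhy dh'y] hhy hy; exact: (diff_proportional (hamvf omega f y) dhy hy ny dh'y hhy).
pose u := dform h' x 0 i / dform h x 0 i.
have dform_h' : dform h' x = u *: dform h x.
  apply/rowP => j; rewrite [RHS]mxE /u mulrAC; apply: (canRL (mulfK ei)).
  have hhx := nbhs_singleton (near_near hh1).
  have P := diff_proportional (delta_mx 0 j) dh h0 nei dh'x hh1.
  by rewrite -3!dform_val -dform_val in P.
have u0 : u != 0.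
  by apply: contraNneq dh'0 => u0; rewrite dform_h' u0 scale0r.
have fh'0 : poisson omega f h' x = 0.
  rewrite poissonE dform_h'; under eq_bigr do rewrite [X in _ * X]mxE mulrCA.
  by rewrite -mulr_sumr -poissonE fh0 mulr0.
have Ei : dform h' x 0 i = u * dform h x 0 i by rewrite dform_h' mxE.
have dE (k : 'rV[R]_n -> R) : twice_diff x k -> differentiable (fun y => dform k y 0 i) x.
  by case.
have dfh := differentiable_poisson un dom tf th.
have dfh' := differentiable_poisson un dom tf th'.
have tangent v : 'd h x v = 0 ->
    'd (poisson omega f h') x v = u * 'd (poisson omega f h) x v.
  move=> hv.
  have [dF FE] := diff_minor v dfh' (dE h th) (dE h' th') dfh.
  have Fz : \forall y \near x, h y = 0 -> poisson omega f h' y * dform h y 0 i -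
      dform h' y 0 i * poisson omega f h y = 0.
    by apply: filterS prop => y E hy; rewrite E // subrr.
  have F0 := diff_eq0_of_zero_set dh h0 nei hv dF Fz.
  (* In the product rule at [x] the terms multiplied by [{f,h'}(x)] or [{f,h}(x)] drop out, and the
     remaining two share the nonzero factor [dh(e)]. *)
  have alg (a b c d p q p' q' : R) : a = 0 -> d = 0 -> c = u * b -> b != 0 ->
      a * p' + b * p - (c * q + d * q') = 0 -> p = u * q.
    move=> -> -> -> b0; rewrite !mul0r add0r addr0 -mulrA mulrCA -mulrBr => /eqP.
    by rewrite mulf_eq0 (negbTE b0) subr_eq0 => /eqP.
  exact: (alg _ _ _ _ _ _ _ _ fh'0 fh0 Ei ei (etrans (esym FE) F0)).
(* Tangency of [Z_f] at [x] is the hypothesis [{f,h}(x) = 0]. In the other bracket the second factor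
   [u] comes from [Z_h' = u Z_h]. *)
exists u => //; split=> //; split; first exact: (tangent _ fh0).
have Zh' : hamvf omega h' x = u *: hamvf omega h x by rewrite /hamvf dform_h' scalemxAl.
have Zh0 := hamvf_skew h sk (nbhs_singleton un).
have -> : poisson omega h' (poisson omega f h') x =
    'd (poisson omega f h') x (u *: hamvf omega h x).
  by rewrite -Zh'.
have -> : 'd (poisson omega f h') x (u *: hamvf omega h x) =
    u * 'd (poisson omega f h') x (hamvf omega h x) by exact: linearZ.
by rewrite (tangent _ Zh0) expr2 -mulrA.
Qed.

End ChangeOfEquation.
End PoissonCalculus.

(** * Chain rule and pull-back of brackets *)

Section ChainRule.
Context {R : realType} {n k : nat}.
Implicit Types (Phi : 'rV[R]_n -> 'rV[R]_k) (h : 'rV[R]_k -> R) (x v : 'rV[R]_n).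

Lemma differentiable_row Phi x :
  (forall j, differentiable (fun y => Phi y 0 j) x) -> differentiable Phi x.
Proof.
move=> dPhi.
have -> : Phi = \sum_(j < k) (fun y => Phi y 0 j *: delta_mx 0 j).
  apply/funext => y; rewrite fct_sumE [LHS]row_sum_delta.
  by [].
apply: differentiable_sum => j.
by apply: differentiableZl; exact: dPhi.
Qed.

Lemma diff_coord (j : 'I_k) (y w : 'rV[R]_k) : 'd (fun z : 'rV[R]_k => z 0 j) y w = w 0 j.
Proof.
have [dc E] : is_diff y (fun z : 'rV[R]_k => z 0 j)
    (fun h : 'rV[R]_k => \sum_i h 0 i * (delta_mx 0 j : 'rV[R]_k) 0 i).
  apply: eps_is_diff => e e0.
  have near1 : \forall h \near (0 : 'rV[R]_k), `|h| <= 1 by exact: nbhs0_le.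
  apply: filterS near1 => h _.
  rewrite (bigD1 j) //= big1 => [|i /negbTE ij]; last by rewrite mxE ij andbF mulr0.
  by rewrite !mxE !eqxx mulr1 addr0 addrK subrr normr0 mulr_ge0 // ltW.
rewrite E (bigD1 j) //= big1 => [|i /negbTE ij]; last by rewrite mxE ij andbF mulr0.
by rewrite mxE !eqxx mulr1 addr0.
Qed.

Lemma jacobian_entry Phi x i j : differentiable Phi x ->
  'J Phi x i j = dform (fun y => Phi y 0 j) x 0 i.
Proof.
move=> dPhi; rewrite dform_val.
have -> : 'd (fun y => Phi y 0 j) x (delta_mx 0 i) = ('d Phi x (delta_mx 0 i)) 0 j.
  have dc : differentiable (fun z : 'rV[R]_k => z 0 j) (Phi x) by exact: differentiable_coord.
  have E := diff_comp dPhi dc.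
  apply: (etrans (congr1 (fun l => l (delta_mx 0 i)) E)).
  exact: diff_coord.
have -> : 'd Phi x (delta_mx 0 i) = (delta_mx 0 i) *m 'J Phi x by rewrite mul_rV_lin1.
by rewrite -rowE [RHS]mxE.
Qed.

Lemma dform_comp Phi h x : differentiable Phi x -> differentiable h (Phi x) ->
  dform (h \o Phi) x = dform h (Phi x) *m ('J Phi x)^T.
Proof.
move=> dPhi dh; apply/rowP => i; rewrite dform_val.
apply: (etrans (congr1 (fun l => l (delta_mx 0 i)) (diff_comp dPhi dh))).
rewrite /= diff_dform mxE; apply: eq_bigr => j _.
rewrite mulrC; congr (_ * _); rewrite [RHS]mxE.
have -> : 'd Phi x (delta_mx 0 i) = (delta_mx 0 i) *m 'J Phi x by rewrite mul_rV_lin1.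
by rewrite -rowE [LHS]mxE.
Qed.

Lemma twice_diff_comp Phi h x : (forall j, twice_diff x (fun y => Phi y 0 j)) ->
  twice_diff (Phi x) h -> twice_diff x (h \o Phi).
Proof.
move=> tPhi [dh ddh].
have dPhi : \forall y \near x, differentiable Phi y.
  have H j : \forall y \near x, differentiable (fun y => Phi y 0 j) y.
    by have [] := tPhi j.
  have HF : \forall y \near x, forall j, differentiable (fun y => Phi y 0 j) y.
    exact: (@filter_forall _ _ _ _ _ H).
  by apply: filterS HF => y; exact: differentiable_row.
have dPhix := nbhs_singleton dPhi.
have Phic : Phi @ x --> Phi x := differentiable_continuous dPhix.
have dhP : \forall y \near x, differentiable h (Phi y) by exact: Phic _ dh.
split; first by apply: filterS2 dPhi dhP => y dP dhy; exact: (differentiable_comp dP dhy).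
move=> i.
have ds : differentiable (fun y => \sum_j dform h (Phi y) 0 j * dform (fun z => Phi z 0 j) y 0 i) x.
  apply: differentiable_sumf => j _; apply: differentiableM.
    exact: (differentiable_comp dPhix (ddh j)).
  by have [_] := tPhi j; apply.
apply: near_eq_differentiable ds; apply: filterS2 dPhi dhP => y dP dhy.
rewrite (dform_comp dP dhy) mxE; apply: eq_bigr => j _; congr (_ * _).
by rewrite [RHS]mxE jacobian_entry.
Qed.

End ChainRule.

Section Pullback.
Context {R : realType} {n : nat}.
Variables (omega : two_form R n) (Phi : 'rV[R]_n -> 'rV[R]_n) (omega' : two_form R n).

(** The differential of [Phi] carries the Hamiltonian vector of [a \o Phi] to that of [a]: the
    factor [J^T] cancels from the defining equation, being invertible because [J W J^T] is. *)
Lemma poisson_pullback (a b : 'rV[R]_n -> R) x : omega x = pullback Phi omega' x ->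
  omega x \in unitmx -> differentiable Phi x ->
  differentiable a (Phi x) -> differentiable b (Phi x) ->
  poisson omega (a \o Phi) (b \o Phi) x = poisson omega' a b (Phi x).
Proof.
move=> pE; rewrite pE /pullback; set J := 'J Phi x; set W := omega' (Phi x) => uJWJ dPhi da db.
have [uJ uW] : J \in unitmx /\ W \in unitmx.
  by move: uJWJ; rewrite !unitmx_mul => /andP[/andP[]].
have uJT : J^T \in unitmx by rewrite unitmx_tr.
rewrite !poisson_mulmx (dform_comp dPhi db) trmx_mul trmxK mulmxA; congr ((_ *m _) 0 0).
rewrite /hamvf pE /pullback -/J -/W (dform_comp dPhi da) -/J.
set Z := _ *m invmx _.
have ZE : Z *m (J *m W *m J^T) = dform a (Phi x) *m J^T by rewrite mulmxKV.
have {}ZE : Z *m J *m W = dform a (Phi x).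
  by apply: (can_inj (mulmxK uJT)); rewrite -ZE !mulmxA.
by rewrite -ZE mulmxK.
Qed.

End Pullback.

(** * Invariance of [kappa] *)

Section Invariance.
Context {R : realType} (cat : category) (m : nat).
Implicit Types (T : triple R m) (h f : 'rV[R]_(m.*2) -> R).

Lemma symplectic_differentiable n (omega : two_form R n) : symplectic_germ cat omega ->
  forall i j, differentiable (fun y => omega y i j) 0.
Proof.
move=> [co _ _ _] i j; have [d _] := smooth_twice_diff (of_class_smooth (co i j)).
exact: (nbhs_singleton d).
Qed.

(** The equations are only asked to be [twice_diff], so that the lemma applies to a pulled-back
    equation [h2 \o Phi] without stability of the classes under composition. *)
Lemma kappa_eq T h h' : symplectic_germ cat (Defs.form T) -> of_class cat (func T) ->
  twice_diff 0 h -> twice_diff 0 h' -> h 0 = 0 ->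
  dform h 0 != 0 -> dform h' 0 != 0 ->
  (\forall x \near (0 : 'rV[R]_(m.*2)), h x = 0 <-> h' x = 0) ->
  poisson (Defs.form T) (func T) h 0 = 0 ->
  poisson (Defs.form T) (func T) h' 0 = 0 /\ kappa T h = kappa T h'.
Proof.
move=> so cf th th' h0 dh dh' hh' fh0.
have dom := symplectic_differentiable so; case: so => _ sk un _.
have tf := smooth_twice_diff (of_class_smooth cf).
have [u u0 [fh'0 [E1 E2]]] :=
  poisson_change_equation un (nbhs_singleton sk) dom tf th th' h0 dh dh' hh' fh0.
split; first exact: fh'0.
have scale (a b : R) : a / b ^+ 2 = u ^+ 2 * a / (u * b) ^+ 2.
  by rewrite exprMn -mulf_div divff ?mul1r // expf_neq0.
exact: etrans (scale _ _) (esym (congr2 (fun a b => a / b ^+ 2) E2 E1)).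
Qed.

Lemma defines_hyper_near h h' (H : set 'rV[R]_(m.*2)) :
  defines_hyper cat h H -> defines_hyper cat h' H ->
  \forall x \near (0 : 'rV[R]_(m.*2)), h x = 0 <-> h' x = 0.
Proof.
move=> [_ _ _ nh] [_ _ _ nh']; apply: filterS2 nh nh' => x e1 e2.
exact: iff_trans (iff_sym e1) e2.
Qed.

Lemma kappa_change_equation T h h' : in_S1 cat T ->
  defines_hyper cat h (hyper T) -> defines_hyper cat h' (hyper T) ->
  kappa T h = kappa T h'.
Proof.
move=> [[so _ cf _] [h0 [H0 [fh0 _ _]]]].
(* The condition [{f,h}(0) = 0] is given for the single equation [h0], with which [h] and [h'] are
   both compared. *)
suff K h1 : defines_hyper cat h1 (hyper T) -> kappa T h0 = kappa T h1.
  by move=> /K <- /K.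
move=> H1; have nn := defines_hyper_near H0 H1.
case: H0 => c0 h00 dh0 _; case: H1 => c1 h10 dh1 _.
have t0 := smooth_twice_diff (of_class_smooth c0).
have t1 := smooth_twice_diff (of_class_smooth c1).
by have [] := kappa_eq so cf t0 t1 h00 dh0 dh1 nn fh0.
Qed.

(** On the first triple one passes from [h1] to the equation [h0] witnessing $S_1$, then to
    [h2 \o Phi]; naturality of brackets under [Phi] reaches the second triple. *)
Lemma kappa_equivalent T1 T2 h1 h2 : in_S1 cat T1 -> in_S1 cat T2 ->
  equivalent cat T1 T2 ->
  defines_hyper cat h1 (hyper T1) -> defines_hyper cat h2 (hyper T2) ->
  kappa T1 h1 = kappa T2 h2.
Proof.
move=> S1 S2 [Phi [[cPhi Phi0 _] pb HH ff]] H1 H2.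
have [h0 [H0 [fh0 _ _]]] := proj2 S1.
rewrite -(kappa_change_equation S1 H0 H1).
have [[so1 _ cf1 _] _] := S1; have [[so2 _ cf2 _] _] := S2.
have tPhi j : twice_diff 0 (fun x => Phi x 0 j) by exact/smooth_twice_diff/of_class_smooth/cPhi.
have dPhi : \forall x \near (0 : 'rV[R]_(m.*2)), differentiable Phi x.
  have H j : \forall y \near (0 : 'rV[R]_(m.*2)), differentiable (fun y => Phi y 0 j) y.
    by have [] := tPhi j.
  have HF : \forall y \near (0 : 'rV[R]_(m.*2)), forall j, differentiable (fun y => Phi y 0 j) y.
    exact: (@filter_forall _ _ _ _ _ H).
  by apply: filterS HF => y; exact: differentiable_row.
have dPhi0 := nbhs_singleton dPhi.
have Phic : Phi @ (0 : 'rV[R]_(m.*2)) --> Phi 0 := differentiable_continuous dPhi0.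
rewrite Phi0 in Phic.
have [c0 h00 dh0 _] := H0; have [c2 h20 dh2 nh2] := H2.
have t0 := smooth_twice_diff (of_class_smooth c0).
have t2 := smooth_twice_diff (of_class_smooth c2).
have tf2 := smooth_twice_diff (of_class_smooth cf2).
have t2' : twice_diff (Phi 0) h2 by rewrite Phi0.
have th := twice_diff_comp tPhi t2'.
have un1 : \forall x \near (0 : 'rV[R]_(m.*2)), Defs.form T1 x \in unitmx by case: so1.
have un2 : \forall x \near (0 : 'rV[R]_(m.*2)), Defs.form T2 x \in unitmx by case: so2.
have dfh2 : differentiable (poisson (Defs.form T2) (func T2) h2) 0.
  exact: (differentiable_poisson un2 (symplectic_differentiable so2) tf2 t2).
have dh2P : \forall x \near (0 : 'rV[R]_(m.*2)), differentiable h2 (Phi x).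
  exact: Phic _ (proj1 t2).
have df2P : \forall x \near (0 : 'rV[R]_(m.*2)), differentiable (func T2) (Phi x).
  exact: Phic _ (proj1 tf2).
(* Equality of the differentials at 0 alone would not do: the outer bracket differentiates the inner
   one. *)
have dform1 : \forall x \near (0 : 'rV[R]_(m.*2)), dform (func T1) x = dform (func T2 \o Phi) x.
  have nff := near_near ff.
  have [d1 _] := smooth_twice_diff (of_class_smooth cf1).
  by apply: filterS2 nff d1 => x e d; exact: near_eq_dform.
have fE x g : dform (func T1) x = dform (func T2 \o Phi) x ->
    poisson (Defs.form T1) (func T1) g x = poisson (Defs.form T1) (func T2 \o Phi) g x.
  by move=> E; rewrite /poisson /hamvf E.
have pE : \forall x \near (0 : 'rV[R]_(m.*2)),
    (poisson (Defs.form T2) (func T2) h2 \o Phi) x = poisson (Defs.form T1) (func T1) (h2 \o Phi) x.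
  have pbu' : \forall x \near (0 : 'rV[R]_(m.*2)),
      Defs.form T1 x = pullback Phi (Defs.form T2) x /\ Defs.form T1 x \in unitmx.
    exact: filterI.
  have dd' : \forall x \near (0 : 'rV[R]_(m.*2)),
      differentiable (func T2) (Phi x) /\ differentiable h2 (Phi x).
    exact: filterI.
  have dd'' : \forall x \near (0 : 'rV[R]_(m.*2)),
      differentiable Phi x /\ dform (func T1) x = dform (func T2 \o Phi) x.
    exact: filterI.
  apply: filterS3 pbu' dd' dd'' => x [e1 e2] [e3 e4] [e5 e6].
  exact: esym (etrans (fE x _ e6) (poisson_pullback e1 e2 e5 e3 e4)).
have pb0 := nbhs_singleton pb; have u0 := nbhs_singleton un1.
have dfh2' : differentiable (poisson (Defs.form T2) (func T2) h2) (Phi 0) by rewrite Phi0.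
have dpE : dform (poisson (Defs.form T1) (func T1) (h2 \o Phi)) 0 =
    dform (poisson (Defs.form T2) (func T2) h2 \o Phi) 0.
  by apply/esym/near_eq_dform => //; exact: (differentiable_comp dPhi0 dfh2').
have gE a b c : dform b (0 : 'rV[R]_(m.*2)) = dform c 0 ->
   poisson (Defs.form T1) a b 0 = poisson (Defs.form T1) a c 0.
  by move=> E; rewrite !poisson_mulmx E.
have df20 := nbhs_singleton df2P; have dh20 := nbhs_singleton dh2P.
pose K2 := poisson (Defs.form T2) (func T2) h2.
have kE : kappa T1 (h2 \o Phi) = kappa T2 h2.
  apply: (congr2 (fun a b => a / b ^+ 2)).
    apply: (etrans (gE (h2 \o Phi) _ _ dpE)).
    apply: (etrans (poisson_pullback pb0 u0 dPhi0 dh20 dfh2')).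
    exact: (congr1 (poisson (Defs.form T2) h2 K2) Phi0).
  apply: (etrans (gE (func T1) _ _ dpE)).
  apply: (etrans (fE 0 _ (nbhs_singleton dform1))).
  apply: (etrans (poisson_pullback pb0 u0 dPhi0 df20 dfh2')).
  exact: (congr1 (poisson (Defs.form T2) (func T2) K2) Phi0).
rewrite -kE.
have dh : dform (h2 \o Phi) 0 != 0.
  have dhE : dform (h2 \o Phi) 0 = dform h2 0 *m ('J Phi 0)^T.
    apply: (etrans (dform_comp dPhi0 dh20)).
    exact: (congr1 (fun y => dform h2 y *m ('J Phi 0)^T) Phi0).
  (* Invertibility of the Jacobian is read off from the nondegenerate form of [T1], which is a
     pull-back under [Phi]. *)
  have uJ : ('J Phi 0)^T \in unitmx.
    rewrite unitmx_tr; move: u0; rewrite pb0 /pullback !unitmx_mul.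
    by case/andP => /andP[].
  apply: contraNneq dh2 => E.
  by rewrite -(mulmxK uJ (dform h2 0)) -dhE E mul0mx.
have zz : \forall x \near (0 : 'rV[R]_(m.*2)), h0 x = 0 <-> (h2 \o Phi) x = 0.
  have nh2P : \forall x \near (0 : 'rV[R]_(m.*2)), hyper T2 (Phi x) <-> h2 (Phi x) = 0.
    exact: Phic _ nh2.
  have [_ _ _ nh0] := H0.
  apply: filterS3 nh0 HH nh2P => x e1 e2 e3.
  exact: (iff_trans (iff_sym e1) (iff_trans e2 e3)).
by have [] := kappa_eq so1 cf1 t0 th h00 dh0 dh zz fh0.
Qed.

End Invariance.

(** * Normal forms *)

Lemma row_wedge (R : realType) k (u a b : 'rV[R]_k) (P : 'M[R]_k) j :
  (u *m (wedge a b + P)) 0 j =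
  (u *m a^T) 0 0 * b 0 j - (u *m b^T) 0 0 * a 0 j + (u *m P) 0 j.
Proof.
rewrite mulmxDr [LHS]mxE /wedge mulmxBr !mulmxA; congr (_ + _).
by rewrite (mx11_scalar (u *m a^T)) (mx11_scalar (u *m b^T)) !mul_scalar_mx !mxE !eqxx !mulr1n.
Qed.

Lemma wedgeE (R : realType) k (a b : 'rV[R]_k) i j :
  wedge a b i j = a 0 i * b 0 j - b 0 i * a 0 j.
Proof. by rewrite /wedge mxE [X in _ + X]mxE !mxE !big_ord1 ![_^T _ _]mxE. Qed.

Lemma wedge_skew (R : realType) k (a b : 'rV[R]_k) : (wedge a b)^T = - wedge a b.
Proof. by apply/matrixP => i j; rewrite mxE [RHS]mxE !wedgeE; ring. Qed.

Lemma skewD (R : realType) k (A B : 'M[R]_k) :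
  A^T = - A -> B^T = - B -> (A + B)^T = - (A + B).
Proof. by move=> sA sB; rewrite raddfD /= sA sB opprD. Qed.

Lemma pullback_skew (R : realType) n k (Phi : 'rV[R]_n -> 'rV[R]_k) (mu : two_form R k) z :
  (mu (Phi z))^T = - mu (Phi z) -> (pullback Phi mu z)^T = - pullback Phi mu z.
Proof.
by move=> sk; rewrite /pullback !trmx_mul trmxK sk mulNmx mulmxN mulmxA.
Qed.

Lemma derive_comb (R : realType) (V : normedModType R) (a b : R) (f g h : V -> R) (z v : V) :
  derivable f z v -> derivable g z v -> derivable h z v ->
  'D_v (fun y => a * f y - b * g y + h y) z = a * 'D_v f z - b * 'D_v g z + 'D_v h z.
Proof.
move=> df dg dh; have da := derivableZ (k := a) df; have db := derivableZ (k := b) dg.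
apply: (etrans (deriveD (derivableB da db) dh)); congr (_ + _).
apply: (etrans (deriveB da db)); congr (_ - _).
  exact: deriveZ.
exact: deriveZ.
Qed.

Section Coordinates.
Context {R : realType} {n : nat}.
Implicit Types z : 'rV[R]_(n.+1.*2).

(** [n.+1.*2] and [n.*2.+2] are convertible; the ascriptions expose a successor so that [ord0] and
    [lift] apply. *)
Definition ix : 'I_(n.+1.*2) := ord0 : 'I_(n.*2.+2).
Definition iy : 'I_(n.+1.*2) := lift ord0 ord0 : 'I_(n.*2.+2).
Definition ipq (j : 'I_(n.*2)) : 'I_(n.+1.*2) :=
  lift ord0 (lift ord0 j : 'I_(n.*2.+1)) : 'I_(n.*2.+2).

Lemma index_cases (i : 'I_(n.+1.*2)) : [\/ i = ix, i = iy | exists j, i = ipq j].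
Proof.
case: (unliftP (ord0 : 'I_(n.*2.+2)) i) => [k ->|->]; last by constructor 1.
case: (unliftP (ord0 : 'I_(n.*2.+1)) k) => [j ->|->]; last by constructor 2.
by constructor 3; exists j.
Qed.

Lemma ipq_inj : injective ipq.
Proof. by move=> a b /lift_inj /lift_inj. Qed.

Lemma ix_iy : ix == iy = false. Proof. by []. Qed.
Lemma iy_ix : iy == ix = false. Proof. by []. Qed.

Lemma xcoordE z : xcoord z = z 0 ix.
Proof. by rewrite /xcoord; congr (z _ _); apply: val_inj; rewrite /= inordK. Qed.

Lemma ycoordE z : ycoord z = z 0 iy.
Proof. by rewrite /ycoord; congr (z _ _); apply: val_inj; rewrite /= inordK. Qed.

Lemma proj_ypqE : @proj_ypq R n = colsub (lift ord0 : 'I_(n.*2.+1) -> 'I_(n.*2.+2)).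
Proof. by apply/funext => z; apply/rowP => j; rewrite !mxE. Qed.

Lemma proj_pqE : @proj_pq R n = colsub ipq.
Proof. by apply/funext => z; apply/rowP => j; rewrite !mxE. Qed.

Lemma jacobian_proj_pq z i j : 'J (@proj_pq R n) z i j = (i == ipq j)%:R.
Proof.
have dE : 'd (colsub ipq : 'rV[R]_(n.+1.*2) -> 'rV[R]_(n.*2)) z =
    colsub ipq :> ('rV[R]_(n.+1.*2) -> 'rV[R]_(n.*2)).
  by apply: diff_lin; exact: colsub_continuous.
by rewrite /jacobian proj_pqE mxE dE !mxE eqxx eq_sym.
Qed.

Lemma row_jacobian_proj_pq z (u : 'rV[R]_(n.+1.*2)) : u *m 'J (@proj_pq R n) z = colsub ipq u.
Proof.
apply/rowP => j; rewrite !mxE (bigD1 (ipq j)) //= jacobian_proj_pq eqxx mulr1.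
rewrite big1 ?addr0 // => i /negbTE ij; by rewrite jacobian_proj_pq ij mulr0.
Qed.

Lemma mul_jacobian_proj_pqT z (v : 'rV[R]_(n.*2)) b :
  (v *m ('J (@proj_pq R n) z)^T) 0 (ipq b) = v 0 b.
Proof.
rewrite mxE (bigD1 b) //= [_^T _ _]mxE jacobian_proj_pq eqxx mulr1.
rewrite big1 ?addr0 // => i ib.
by rewrite [_^T _ _]mxE jacobian_proj_pq (inj_eq ipq_inj) eq_sym (negbTE ib) mulr0.
Qed.

Lemma mul_jacobian_proj_pqT0 z (v : 'rV[R]_(n.*2)) j : (forall b, j != ipq b) ->
  (v *m ('J (@proj_pq R n) z)^T) 0 j = 0.
Proof.
move=> nj; rewrite mxE big1 // => i _.
by rewrite [_^T _ _]mxE jacobian_proj_pq (negbTE (nj i)) mulr0.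
Qed.

Variable mu : two_form R n.*2.
Local Notation M := (pullback (@proj_pq R n) mu).

Lemma row_pullback_proj_pq z (u : 'rV[R]_(n.+1.*2)) b :
  (u *m M z) 0 (ipq b) = (colsub ipq u *m mu (colsub ipq z)) 0 b.
Proof.
by rewrite /pullback !mulmxA row_jacobian_proj_pq mul_jacobian_proj_pqT proj_pqE.
Qed.

Lemma row_pullback_proj_pq0 z (u : 'rV[R]_(n.+1.*2)) j : (forall b, j != ipq b) ->
  (u *m M z) 0 j = 0.
Proof. by move=> nj; rewrite /pullback !mulmxA mul_jacobian_proj_pqT0. Qed.

Lemma entry_row m k (A : 'M[R]_(m, k)) i j : A i j = ((delta_mx 0 i : 'rV[R]_m) *m A) 0 j.
Proof. by rewrite -rowE mxE. Qed.

Lemma pullback_proj_pq_entry z a b : M z (ipq a) (ipq b) = mu (colsub ipq z) a b.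
Proof.
by rewrite entry_row row_pullback_proj_pq colsub_delta -?entry_row //; exact: ipq_inj.
Qed.

Lemma pullback_proj_pq_row0 z i j : (forall a, i != ipq a) -> M z i j = 0.
Proof.
move=> ni; rewrite entry_row.
have [->|->|[b ->]] := index_cases j; [exact: row_pullback_proj_pq0|exact: row_pullback_proj_pq0|].
rewrite row_pullback_proj_pq colsub_delta0 ?mul0mx ?mxE // => a.
by rewrite eq_sym.
Qed.

Lemma pullback_proj_pq_col0 z i j : (forall b, j != ipq b) -> M z i j = 0.
Proof. by move=> nj; rewrite entry_row row_pullback_proj_pq0. Qed.

End Coordinates.

(** * A model containing both normal forms *)

Section Model.
Context {R : realType} (cat : category) {n : nat}.
Variables (F : 'rV[R]_(n.+1.*2) -> R) (mu : two_form R n.*2) (gam : R).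
Hypotheses (cF : of_class cat F) (F0 : F 0 = 0)
  (Fx : forall z (t : R), F (t *: delta_mx 0 ix + z) = F z)
  (Fy : 'D_(delta_mx 0 iy) F 0 = gam) (gam0 : gam != 0)
  (Fpq : (1 <= n)%N -> exists2 j, j != iy & 'D_(delta_mx 0 j) F 0 != 0)
  (smu : symplectic_germ cat mu).

(** The section hypotheses retain what the computation uses: [F] does not depend on $x$, its
    $y$-derivative at 0 is [gam], and for [n >= 1] another partial derivative is nonzero at 0, which
    makes [df] and [dh] independent there. *)
Definition model_triple : triple R n.+1 :=
  Triple (fun z => wedge (dform (@xcoord R n) z) (dform F z) + pullback (@proj_pq R n) mu z)
    (@parabola R n) F.

Local Notation W := (Defs.form model_triple).
Local Notation V := 'rV[R]_(n.+1.*2).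

Definition parabola_eq (z : V) : R := z 0 iy + z 0 ix ^+ 2.

Lemma dform_xcoord z : dform (@xcoord R n) z = delta_mx 0 ix.
Proof.
apply/rowP => i; rewrite dform_val.
have -> : @xcoord R n = fun z : V => z 0 ix by apply/funext => y; exact: xcoordE.
by rewrite diff_coord !mxE eqxx eq_sym.
Qed.

Lemma row_modelE (u : V) z j : (u *m W z) 0 j =
  u 0 ix * dform F z 0 j - 'd F z u * (j == ix)%:R + (u *m pullback (@proj_pq R n) mu z) 0 j.
Proof.
rewrite /= row_wedge dform_xcoord; congr (_ * _ - _ * _ + _).
- by rewrite trmx_delta -colE mxE.
- by rewrite diff_dform mxE; apply: eq_bigr => i _; rewrite [_^T _ _]mxE.
- by rewrite mxE eqxx.
Qed.

Lemma near_smooth : exists U : set V, [/\ open U, U 0 & forall k, Ck_on U k F].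
Proof. exact: of_class_smooth cF. Qed.

Lemma derive_ix z : 'D_(delta_mx 0 ix) F z = 0.
Proof.
rewrite /derive; apply: lim_near_cst => //; rewrite near_withinE; near=> h => h0.
by rewrite /= Fx subrr scaler0.
Unshelve. all: by end_near. Qed.

Lemma near_differentiable : \forall z \near (0 : V), differentiable F z.
Proof. by have [] := smooth_twice_diff (of_class_smooth cF). Qed.

(** For [u] in the kernel, the $y$-component gives $u_x=0$, the $x$-component then gives $dF(u)=0$,
    and the others put the $(p,q)$-part of [u] in the kernel of [mu]. What is left of $dF(u)=0$ is
    $F_y u_y=0$. *)
Lemma model_unit z : dform F z 0 ix = 0 -> dform F z 0 iy != 0 ->
  mu (colsub ipq z) \in unitmx -> W z \in unitmx.
Proof.
move=> Fz0 Fzy umu; rewrite -row_free_unit; apply: inj_row_free => u uW.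
have E j : u 0 ix * dform F z 0 j - 'd F z u * (j == ix)%:R +
    (u *m pullback (@proj_pq R n) mu z) 0 j = 0 by rewrite -row_modelE uW mxE.
have ux : u 0 ix = 0.
  have := E iy; rewrite eq_sym ix_iy mulr0 subr0 row_pullback_proj_pq0 //.
  by rewrite addr0 => /eqP; rewrite mulf_eq0 (negbTE Fzy) orbF => /eqP.
have uF : 'd F z u = 0.
  have := E ix; rewrite eqxx mulr1 row_pullback_proj_pq0 // addr0 ux mul0r sub0r.
  by move/eqP; rewrite oppr_eq0 => /eqP.
have upq : colsub ipq u = 0.
  have upq0 : colsub ipq u *m mu (colsub ipq z) = 0.
    apply/rowP => b; rewrite -row_pullback_proj_pq [RHS]mxE.
    by have := E (ipq b); rewrite ux uF !mul0r subr0 add0r.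
  by rewrite -(mulmxK umu (colsub ipq u)) upq0 mul0mx.
have upq' b : u 0 (ipq b) = 0 by have /rowP/(_ b) := upq; rewrite !mxE.
have uy : u 0 iy = 0.
  move: uF; rewrite diff_dform (bigD1 iy) //= big1 ?addr0.
    by move/eqP; rewrite mulf_eq0 (negbTE Fzy) orbF => /eqP.
  move=> i; have [->|->|[b ->]] := index_cases i; first by rewrite ux mul0r.
    by rewrite eqxx.
  by rewrite upq' mul0r.
apply/rowP => i; rewrite [RHS]mxE.
by have [->|->|[b ->]] := index_cases i.
Qed.

(** Contracting the form with the unit vector along $x$ gives $dF-F_x\,dx$, since the pull-back of
    [mu] does not see $x$, and $F_x=0$. *)
Lemma model_hamvf z : W z \in unitmx -> dform F z 0 ix = 0 ->
  hamvf W F z = delta_mx 0 ix.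
Proof.
move=> un Fz0; apply/esym/(hamvfP F (delta_mx 0 ix) un)/rowP => j.
rewrite row_modelE mxE !eqxx mul1r -dform_val Fz0 mul0r subr0.
have [->|->|[b ->]] := index_cases j.
- by rewrite row_pullback_proj_pq0 ?addr0.
- by rewrite row_pullback_proj_pq0 ?addr0.
by rewrite row_pullback_proj_pq colsub_delta0 ?mul0mx ?[(0 : 'rV__) _ _]mxE ?addr0.
Qed.

Lemma near_ypq (P : 'rV[R]_(n.*2) -> Prop) :
  (\forall w \near (0 : 'rV[R]_(n.*2)), P w) -> \forall z \near (0 : V), P (colsub ipq z).
Proof.
move=> nP.
have c : colsub ipq @ (0 : V) --> colsub ipq (0 : V) :=
  @colsub_continuous R _ _ ipq (0 : V).
rewrite linear0 in c.
exact: c _ nP.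
Qed.

Lemma near_dform_ix : \forall z \near (0 : V), dform F z 0 ix = 0.
Proof.
apply: filterS near_differentiable => z dz; rewrite dformE //; exact: derive_ix.
Qed.

Lemma dform_iy : dform F 0 0 iy = gam.
Proof. by rewrite dformE ?Fy //; exact: nbhs_singleton near_differentiable. Qed.

Lemma near_dform_iy : \forall z \near (0 : V), dform F z 0 iy != 0.
Proof.
have t := smooth_twice_diff (of_class_smooth cF).
have c := twice_diff_continuous_dform (i := iy) t.
have ne : dform F 0 0 iy != 0 by rewrite dform_iy.
exact: (@cvgr_neq0 R R _ (nbhs (0 : V)) _ (fun y => dform F y 0 iy) (dform F 0 0 iy) c ne).
Qed.

Lemma near_unit : \forall z \near (0 : V), W z \in unitmx.
Proof.
have umu : \forall z \near (0 : V), mu (colsub ipq z) \in unitmx.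
  by apply: (near_ypq (P := fun w => mu w \in unitmx)); case: smu.
by apply: filterS3 near_dform_ix near_dform_iy umu => z; exact: model_unit.
Qed.

Lemma model_skew : \forall z \near (0 : V), (W z)^T = - W z.
Proof.
have smu' : \forall z \near (0 : V), (mu (colsub ipq z))^T = - mu (colsub ipq z).
  by apply: (near_ypq (P := fun w => (mu w)^T = - mu w)); case: smu.
apply: filterS smu' => z sk.
have skw := wedge_skew (dform (@xcoord R n) z) (dform F z).
have skp : (pullback (@proj_pq R n) mu z)^T = - pullback (@proj_pq R n) mu z.
  by apply: pullback_skew; rewrite proj_pqE.
exact: skewD.
Qed.

Lemma model_entry z i j : differentiable F z -> W z i j =
  (i == ix)%:R * 'D_(delta_mx 0 j) F z - (j == ix)%:R * 'D_(delta_mx 0 i) F z +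
  pullback (@proj_pq R n) mu z i j.
Proof.
move=> dz; rewrite entry_row row_modelE -entry_row; congr (_ + _).
rewrite mxE eqxx [ix == _]eq_sym -deriveE // dformE //; congr (_ - _).
by rewrite mulrC.
Qed.

Lemma of_class_pullback i j : of_class cat (fun z => pullback (@proj_pq R n) mu z i j).
Proof.
have [[a ->]|ni] := pselect (exists a, i = ipq a); last first.
  have -> : (fun z => pullback (@proj_pq R n) mu z i j) = fun=> 0.
    by apply/funext => z; apply: pullback_proj_pq_row0 => a; apply/eqP => ia; apply: ni; exists a.
  exact: of_class_cst.
have [[b ->]|nj] := pselect (exists b, j = ipq b); last first.
  have -> : (fun z => pullback (@proj_pq R n) mu z (ipq a) j) = fun=> 0.
    by apply/funext => z; apply: pullback_proj_pq_col0 => b; apply/eqP => jb; apply: nj; exists b.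
  exact: of_class_cst.
have -> : (fun z => pullback (@proj_pq R n) mu z (ipq a) (ipq b)) =
    (fun w => mu w a b) \o colsub ipq.
  by apply/funext => z; exact: pullback_proj_pq_entry.
by apply: of_class_colsub; [exact: ipq_inj|case: smu].
Qed.

Lemma model_entries i j : of_class cat (fun z => W z i j).
Proof.
have c : of_class cat (fun z => (i == ix)%:R * 'D_(delta_mx 0 j) F z +
    (- (j == ix)%:R) * 'D_(delta_mx 0 i) F z + pullback (@proj_pq R n) mu z i j).
  apply: of_classD; last exact: of_class_pullback.
  by apply: of_classD; apply: of_classZ; exact: of_class_partial.
apply: of_class_near_eq c; apply: filterS near_differentiable => z dz.
by rewrite model_entry // mulNr.
Qed.

(** Entries of the pull-back vanish unless both indices are of type [ipq], and these entries are
    constant along $x$ and $y$. *)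
Lemma derive_pullback z i j k :
  ('D_(delta_mx 0 i) (fun z => pullback (@proj_pq R n) mu z j k) z = 0) \/
  exists a b c, [/\ i = ipq a, j = ipq b & k = ipq c].
Proof.
have [[b jb]|nj] := pselect (exists a, j = ipq a); last first.
  left; have -> : (fun z => pullback (@proj_pq R n) mu z j k) = fun=> 0.
    by apply/funext => y; apply: pullback_proj_pq_row0 => a; apply/eqP => ia; apply: nj; exists a.
  exact: derive_cst.
have [[c kc]|nk] := pselect (exists b, k = ipq b); last first.
  left; have -> : (fun z => pullback (@proj_pq R n) mu z j k) = fun=> 0.
    by apply/funext => y; apply: pullback_proj_pq_col0 => a; apply/eqP => ia; apply: nk; exists a.
  exact: derive_cst.
have [[a ia]|ni] := pselect (exists a, i = ipq a); first by right; exists a, b, c.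
left; rewrite jb kc.
have -> : (fun z => pullback (@proj_pq R n) mu z (ipq b) (ipq c)) =
    (fun w => mu w b c) \o colsub ipq.
  by apply/funext => y; exact: pullback_proj_pq_entry.
rewrite derive_colsub colsub_delta0 ?derive0 // => a.
by apply/eqP => ai; apply: ni; exists a.
Qed.

Lemma derive_pullback_ipq z a b c :
  'D_(delta_mx 0 (ipq a)) (fun z => pullback (@proj_pq R n) mu z (ipq b) (ipq c)) z =
  'D_(delta_mx 0 a) (fun w => mu w b c) (colsub ipq z).
Proof.
have -> : (fun z => pullback (@proj_pq R n) mu z (ipq b) (ipq c)) =
    (fun w => mu w b c) \o colsub ipq.
  by apply/funext => y; exact: pullback_proj_pq_entry.
by rewrite derive_colsub colsub_delta //; exact: ipq_inj.
Qed.

(** Either all three indices are of type [ipq] and the cyclic sum is that of [mu], or each of its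
    terms vanishes. *)
Lemma pullback_closed : closed_form (pullback (@proj_pq R n) mu).
Proof.
have cmu : closed_form mu by case: smu.
have := near_ypq cmu; apply: filterS => z zc i j k.
have [D1|[a [b [c [-> -> ->]]]]] := derive_pullback z i j k; last first.
  by rewrite !derive_pullback_ipq; exact: zc.
have [D2|[b [c [a [-> -> ->]]]]] := derive_pullback z j k i; last first.
  by rewrite !derive_pullback_ipq; exact: zc.
have [D3|[c [a [b [-> -> ->]]]]] := derive_pullback z k i j; last first.
  by rewrite !derive_pullback_ipq; exact: zc.
by rewrite D1 D2 D3 !addr0.
Qed.

Lemma near_differentiable_pullback : \forall z \near (0 : V), forall j k,
  differentiable (fun y => pullback (@proj_pq R n) mu y j k) z.
Proof.
have H (p : 'I_(n.+1.*2) * 'I_(n.+1.*2)) : \forall z \near (0 : V),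
    differentiable (fun y => pullback (@proj_pq R n) mu y p.1 p.2) z.
  by have [] := smooth_twice_diff (of_class_smooth (of_class_pullback p.1 p.2)).
have HF : \forall z \near (0 : V), forall p : 'I_(n.+1.*2) * 'I_(n.+1.*2),
    differentiable (fun y => pullback (@proj_pq R n) mu y p.1 p.2) z.
  exact: (@filter_forall _ _ _ _ _ H).
by apply: filterS HF => z Hz j k; exact: (Hz (j, k)).
Qed.

Lemma model_closed : closed_form W.
Proof.
have [U [oU U0 cU]] := near_smooth; have nU := near_open oU U0.
apply: filterS3 nU pullback_closed near_differentiable_pullback => z Uz zM dM i j k.
have dF y : U y -> differentiable F y by move=> Uy; exact: Ck_on1_differentiable (cU 1%N) Uy.
have dDF a b : derivable (fun y => 'D_(delta_mx 0 a) F y) z (delta_mx 0 b).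
  have [_ c] := cU 2%N a.
  by apply: diff_derivable; exact: Ck_on1_differentiable oU c Uz.
have sym a b := Ck_on2_symmetric a b oU (cU 2%N) Uz.
have DW a b c : 'D_(delta_mx 0 a) (fun y => W y b c) z =
    (b == ix)%:R * 'D_(delta_mx 0 a) (fun y => 'D_(delta_mx 0 c) F y) z -
    (c == ix)%:R * 'D_(delta_mx 0 a) (fun y => 'D_(delta_mx 0 b) F y) z +
    'D_(delta_mx 0 a) (fun y => pullback (@proj_pq R n) mu y b c) z.
  have E : \forall y \near z, W y b c = (b == ix)%:R * 'D_(delta_mx 0 c) F y -
      (c == ix)%:R * 'D_(delta_mx 0 b) F y + pullback (@proj_pq R n) mu y b c.
    by apply: filterS (near_open oU Uz) => y Uy; apply: model_entry; exact: dF.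
  apply: (etrans (near_eq_derive (delta_mx 0 a) E)).
  apply: derive_comb; [exact: dDF|exact: dDF|].
  exact: diff_derivable (dM b c).
(* The second derivatives of [F] cancel in pairs by symmetry; the pull-back contributes its own
   vanishing cyclic sum. *)
have alg (s t u p p' q q' r r' m1 m2 m3 : R) : p = p' -> q = q' -> r = r' ->
    m1 + m2 + m3 = 0 ->
    (s * p - t * q + m1) + (t * q' - u * r + m2) + (u * r' - s * p' + m3) = 0.
  by move=> -> -> -> E; rewrite -[RHS]E; ring.
rewrite (DW i j k) (DW j k i) (DW k i j).
exact: (alg _ _ _ _ _ _ _ _ _ _ _ _ (sym k i) (sym j i) (sym k j) (zM i j k)).
Qed.

Lemma diff_parabola_eq z : is_diff z parabola_eq
  (fun w : V => \sum_i w 0 i * (delta_mx 0 iy + (2 * z 0 ix) *: delta_mx 0 ix : V) 0 i).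
Proof.
apply: eps_is_diff => e e0.
have near_e : \forall w \near (0 : V), `|w| <= e by exact: nbhs0_le.
apply: filterS near_e => w we.
have -> : \sum_i w 0 i * (delta_mx 0 iy + (2 * z 0 ix) *: delta_mx 0 ix : V) 0 i =
    w 0 iy + 2 * z 0 ix * w 0 ix.
  rewrite (bigD1 iy) //= (bigD1 ix) //= big1 => [|i /andP[iy' ix']].
    by rewrite !mxE !eqxx ix_iy iy_ix /=; ring.
  by rewrite !mxE (negbTE iy') (negbTE ix') !andbF mulr0 addr0 mulr0.
have -> : parabola_eq (w + z) - parabola_eq z - (w 0 iy + 2 * z 0 ix * w 0 ix) = w 0 ix ^+ 2.
  by rewrite /parabola_eq !mxE; ring.
by rewrite normrX expr2 ler_pM // ?norm_rV_le // (le_trans (norm_rV_le w ix)).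
Qed.

Lemma dform_parabola_eq z : dform parabola_eq z = delta_mx 0 iy + (2 * z 0 ix) *: delta_mx 0 ix.
Proof.
apply/rowP => i; rewrite dform_val; have [_ ->] := diff_parabola_eq z.
rewrite (bigD1 i) //= big1 => [|j ji]; last by rewrite [X in X * _]mxE (negbTE ji) andbF mul0r.
by rewrite addr0 [X in X * _]mxE !eqxx mul1r.
Qed.

Lemma model_is_triple : is_triple cat model_triple /\
  defines_hyper cat parabola_eq (hyper model_triple).
Proof.
have H : defines_hyper cat parabola_eq (hyper model_triple).
  split.
  - apply: of_classD; last exact: of_class_coordX.
    exact: (of_class_coordX cat iy 1).
  - by rewrite /parabola_eq !mxE expr0n addr0.
  - rewrite dform_parabola_eq mxE mulr0 scale0r addr0.
    apply/eqP => /rowP/(_ iy); rewrite !mxE !eqxx => /eqP; by rewrite oner_eq0.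
  - by apply: filterS near_differentiable => z _; rewrite /= /parabola /= xcoordE ycoordE.
split=> //; split=> //; last by exists parabola_eq.
split; [exact: model_entries|exact: model_skew|exact: near_unit|exact: model_closed].
Qed.

Lemma poisson_F h z : W z \in unitmx -> dform F z 0 ix = 0 ->
  poisson W F h z = dform h z 0 ix.
Proof. by move=> un Fz; rewrite /poisson model_hamvf // dform_val. Qed.

Lemma near_bracket : \forall z \near (0 : V), 2 * (z : V) 0 ix = poisson W F parabola_eq z.
Proof.
apply: filterS2 near_unit near_dform_ix => z un Fz.
by rewrite poisson_F // dform_parabola_eq !mxE !eqxx ix_iy add0r mulr1.
Qed.

Lemma dform_bracket : dform (poisson W F parabola_eq) 0 = 2 *: delta_mx 0 ix.
Proof.
have D : is_diff (0 : V) (fun z : V => 2 * z 0 ix)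
    (fun w : V => \sum_i w 0 i * (2 *: delta_mx 0 ix : V) 0 i).
  apply: eps_is_diff => e e0.
  have near_e : \forall w \near (0 : V), `|w| <= e by exact: nbhs0_le.
  apply: filterS near_e => w we; rewrite (bigD1 ix) //= big1 => [|i /negbTE ii].
    by rewrite !mxE !eqxx !addr0 !mulr0 mulr1 subr0 [_ * 2]mulrC subrr normr0 mulr_ge0 // ltW.
  by rewrite !mxE ii andbF !mulr0.
apply: (etrans (esym (near_eq_dform (@ex_diff _ _ _ _ _ _ _ D) near_bracket))).
apply/rowP => i; rewrite dform_val; have [_ ->] := D.
rewrite (bigD1 i) //= big1 => [|j ji]; last by rewrite [X in X * _]mxE (negbTE ji) andbF mul0r.
by rewrite addr0 [X in X * _]mxE !eqxx mul1r.
Qed.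

Lemma hamvf_parabola_ix : hamvf W parabola_eq 0 0 ix = gam^-1.
Proof.
have un := nbhs_singleton near_unit.
set Z := hamvf W parabola_eq 0.
have ZE : Z *m W 0 = dform parabola_eq 0 by exact: (hamvfP parabola_eq Z un).2.
clearbody Z.
have one : dform parabola_eq 0 0 iy = 1.
  by rewrite dform_parabola_eq !mxE !eqxx iy_ix /=; ring.
(* The $dy$-coefficient of [Z _| omega = dh], to which only $Z_x\,dF$ contributes. *)
have E : 1 = Z 0 ix * gam - 'd F 0 Z * ((iy : 'I_(n.+1.*2)) == ix)%:R + 0.
  apply: (etrans (esym one)); rewrite -ZE row_modelE dform_iy; congr (_ + _).
  exact: row_pullback_proj_pq0.
apply: (mulIf gam0); by rewrite mulVf // E iy_ix mulr0 subr0 addr0.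
Qed.

(** For the equation $y+x^2$ the numerator of [kappa] is [2 / gam] and the bracket squared in its
    denominator is 2, whence [(2 / gam) / 4]. Other equations give the same value by
    [kappa_change_equation]. *)
Lemma model_S1_kappa : in_S1 cat model_triple /\
  forall h, defines_hyper cat h (hyper model_triple) -> kappa model_triple h = 1 / (2 * gam).
Proof.
have [tT H] := model_is_triple.
have un := nbhs_singleton near_unit; have Fz := nbhs_singleton near_dform_ix.
have B1 : poisson W F parabola_eq 0 = 0.
  by rewrite -(nbhs_singleton near_bracket) mxE mulr0.
have B2 : poisson W F (poisson W F parabola_eq) 0 = 2.
  by rewrite (poisson_F _ un Fz) dform_bracket !mxE !eqxx mulr1.
have B3 : poisson W parabola_eq (poisson W F parabola_eq) 0 = 2 / gam.
  rewrite poissonE dform_bracket (bigD1 ix) //= big1 => [|i /negbTE ii].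
    by rewrite hamvf_parabola_ix !mxE !eqxx mulr1 addr0 mulrC.
  by rewrite [X in _ * X]mxE [X in _ * (_ * X)]mxE ii andbF !mulr0.
have S : in_S1 cat model_triple.
  split=> //; exists parabola_eq; split=> //; split=> //; first by rewrite B2.
  move=> n2; split; first by rewrite B3 mulf_neq0 // invr_eq0.
  (* [2 <= n.+1] computes to [1 <= n]. As [dh(0) = dy], the entry [(j, iy)] of the wedge is the
     nonzero partial derivative $F_j(0)$. *)
  have [j jy Fj] := Fpq n2.
  have Fj' : dform F 0 0 j != 0 by rewrite dformE //; exact: nbhs_singleton near_differentiable.
  have py : dform parabola_eq 0 0 iy = 1.
    by rewrite dform_parabola_eq !mxE !eqxx iy_ix /=; ring.
  have pj : dform parabola_eq 0 0 j = 0.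
    by rewrite dform_parabola_eq !mxE (negbTE jy) andbF mulr0 mul0r addr0.
  apply: contraNneq Fj' => w0; apply/eqP.
  have W0 : wedge (dform F 0) (dform parabola_eq 0) j iy = 0 by rewrite w0 mxE.
  have alg (a b c d : R) : b = 1 -> c = 0 -> a * b - c * d = 0 -> a = 0.
    by move=> -> ->; rewrite mulr1 mul0r subr0.
  exact: (alg _ _ _ _ py pj (etrans (esym (wedgeE _ _ _ _)) W0)).
split=> // h Hh; rewrite (kappa_change_equation S Hh H) /kappa.
rewrite B2 B3; field; exact: gam0.
Qed.

End Model.

(** * The two normal forms as instances of the model *)

Section NormalForms.
Context {R : realType} (cat : category).

(** A directional derivative sees only one line, so [F] can be replaced by a simpler function
    agreeing with it on one axis. *)
Lemma eq_derive_line (V : normedModType R) (F G : V -> R) (v : V) :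
  (forall t : R, F (t *: v) = G (t *: v)) -> 'D_v F 0 = 'D_v G 0.
Proof.
move=> FG; rewrite /derive.
rewrite (_ : (fun h : R => h^-1 *: ((F \o shift 0) (h *: v) - F 0)) =
  (fun h : R => h^-1 *: ((G \o shift 0) (h *: v) - G 0))) //.
by apply/funext => t /=; rewrite !addr0 FG -(scale0r v) FG.
Qed.

Lemma of_class_coord_comp n (i : 'I_n) (g : R -> R) :
  of_class cat (fun v : 'rV[R]_1 => g (v 0 0)) ->
  of_class cat (fun z : 'rV[R]_n => g (z 0 i)).
Proof.
move=> cg.
have -> : (fun z : 'rV[R]_n => g (z 0 i)) =
    (fun v : 'rV[R]_1 => g (v 0 0)) \o colsub (fun=> i).
  by apply/funext => z /=; rewrite mxE.
by apply: of_class_colsub => // a b _; rewrite (ord1 a) (ord1 b).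
Qed.

Lemma derive_coord_comp n (i : 'I_n) (g : R -> R) :
  'D_(delta_mx 0 i) (fun z : 'rV[R]_n => g (z 0 i)) 0 = derive1 g 0.
Proof.
rewrite /derive /derive1.
rewrite (_ : (fun h : R => h^-1 *: (((fun z : 'rV[R]_n => g (z 0 i)) \o shift 0)
    (h *: delta_mx 0 i) - g ((0 : 'rV[R]_n) 0 i))) =
  (fun h : R => h^-1 *: (g (h + 0) - g 0))) //.
by apply/funext => t /=; rewrite !mxE !eqxx mulr1.
Qed.

Lemma pullback_dim0 n (Phi : 'rV[R]_n -> 'rV[R]_0) mu z : pullback Phi mu z = 0.
Proof. by apply/matrixP => i j; rewrite /pullback mxE big_ord0 mxE. Qed.

(** Provides [mu] for [n = 0], the plane case of the model. *)
Lemma symplectic_dim0 : symplectic_germ cat (fun _ : 'rV[R]_0 => 0 : 'M[R]_0).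
Proof.
have all0 (P : 'rV[R]_0 -> Prop) : (forall x, P x) -> \forall x \near (0 : 'rV[R]_0), P x.
  move=> Px; have n1 : \forall x \near (0 : 'rV[R]_0), `|x| <= 1 by exact: nbhs0_le.
  by apply: filterS n1 => x _.
split.
- by case.
- by apply: all0 => x; apply/matrixP => -[].
- by apply: all0 => x; rewrite unitmxE det_mx00 unitr1.
- by apply: all0 => x; case.
Qed.

Lemma plane_S1_kappa (g : R -> R) : of_class cat (fun v : 'rV[R]_1 => g (v 0 0)) ->
  g 0 = 0 -> derive1 g 0 != 0 ->
  in_S1 cat (triple_plane g) /\
  forall h : 'rV[R]_(1.*2) -> R,
    defines_hyper cat h (hyper (triple_plane g)) ->
    kappa (triple_plane g) h = 1 / (2 * derive1 g 0).
Proof.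
move=> cg g0 dg.
have gE : (fun z => g (@ycoord R 0 z)) = (fun z => g (z 0 iy)).
  by apply/funext => z; rewrite ycoordE.
have -> : triple_plane g =
    @model_triple R 0 (fun z => g (z 0 iy)) (fun _ : 'rV[R]_0 => 0 : 'M[R]_0).
  rewrite /triple_plane /model_triple gE; congr Triple; apply/funext => z.
  by rewrite pullback_dim0 addr0.
apply: model_S1_kappa => //.
- exact: of_class_coord_comp.
- by rewrite mxE.
- by move=> z t; rewrite !mxE eqxx iy_ix mulr0 add0r.
- exact: derive_coord_comp.
- exact: symplectic_dim0.
Qed.

Section Higher.
Variables (n : nat) (g : R -> R) (phi : 'rV[R]_(n.*2.+1) -> R).
Hypotheses (n1 : (1 <= n)%N) (cg : of_class cat (fun v : 'rV[R]_1 => g (v 0 0)))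
  (g0 : g 0 = 0) (cphi : of_class cat phi).
Local Notation V := 'rV[R]_(n.+1.*2).

(** Position in $(x,y,p,q)$ of the coordinate of index [i] in $(y,p,q)$: for $1\le i\le n$, [ip i]
    locates $p_i$ and [ip (n + i)] locates $q_i$. *)
Let ip (i : nat) : 'I_(n.+1.*2) := lift ord0 (inord i : 'I_(n.*2.+1)) : 'I_(n.*2.+2).
Let s0 : 'I_(n.*2.+1) -> 'I_(n.+1.*2) := lift ord0 : _ -> 'I_(n.*2.+2).
Let F (z : V) := Fypq g phi (proj_ypq z).

Let FE z : F z = g (z 0 iy) +
  \sum_(1 <= i < n.+1) (z 0 (ip i) * z 0 iy ^+ (2 * i - 2) +
                        z 0 (ip (n + i)) * z 0 iy ^+ (2 * i - 1)) +
  z 0 iy ^+ (2 * n) * phi (colsub s0 z).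
Proof.
rewrite /F /Fypq proj_ypqE; congr (g _ + _ + _ ^+ _ * _); rewrite ?mxE //.
by apply: eq_bigr => i _; rewrite !mxE.
Qed.

Lemma of_class_phi : of_class cat (fun z : V => phi (colsub s0 z)).
Proof. by apply: of_class_colsub => // a b /lift_inj. Qed.

Lemma of_class_Fypq : of_class cat F.
Proof.
have -> : F = (fun z => g (z 0 iy) +
    \sum_(1 <= i < n.+1) (z 0 (ip i) * z 0 iy ^+ (2 * i - 2) +
                          z 0 (ip (n + i)) * z 0 iy ^+ (2 * i - 1)) +
    z 0 iy ^+ (2 * n) * phi (colsub s0 z)).
  by apply/funext => z; exact: FE.
apply: of_classD; last exact/of_class_coordXM/of_class_phi.
apply: of_classD; first exact: of_class_coord_comp.
apply: of_class_sum => i.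
by apply: of_classD; apply: of_class_coordM; exact: of_class_coordX.
Qed.

Lemma ip_iy i : (0 < i <= n + n)%N -> ip i == iy = false.
Proof.
move=> /andP[i0 iN]; apply/eqP => /lift_inj /(congr1 val) /=.
by rewrite inordK /= ?ltnS -?addnn // => i0'; rewrite i0' in i0.
Qed.

(** On the $y$-axis the terms in $p$ and $q$ vanish. One factor [t] is split off [t ^+ (2 * n)] for
    the product rule; the other factor still vanishes at 0, as $2n-1>0$. *)
Lemma Fypq_iy (t : R) : F (t *: delta_mx 0 iy) =
  g t + t * (t ^+ (2 * n).-1 * phi (colsub s0 (t *: delta_mx 0 iy))).
Proof.
rewrite FE [in g _]mxE [in g _]mxE !eqxx mulr1 big_nat big1 ?addr0.
  rewrite mulrA -exprS prednK ?muln_gt0 //; congr (_ + _ ^+ _ * _).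
  by rewrite !mxE !eqxx mulr1.
move=> i /andP[i1 iN].
have z0 k : (0 < k <= n + n)%N -> (t *: delta_mx 0 iy : V) 0 (ip k) = 0.
  by move=> kP; rewrite !mxE ip_iy // mulr0.
rewrite !z0 ?mul0r ?addr0 //; apply/andP; split.
- by rewrite addn_gt0 n1.
- by rewrite leq_add2l -ltnS.
- by [].
- by rewrite (leq_trans _ (leq_addr _ _)) // -ltnS.
Qed.

Lemma derive_iy_Fypq : 'D_(delta_mx 0 iy) F 0 = derive1 g 0.
Proof.
pose b (z : V) := z 0 iy ^+ (2 * n).-1 * phi (colsub s0 z).
have cb : of_class cat b by exact/of_class_coordXM/of_class_phi.
have diffC (f : V -> R) : of_class cat f -> derivable f 0 (delta_mx 0 iy).
  move=> cf; have [d _] := smooth_twice_diff (of_class_smooth cf).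
  exact: diff_derivable (nbhs_singleton d).
have dg := diffC _ (of_class_coord_comp iy cg).
have db := diffC _ cb.
have dy := diffC _ (of_class_coordX cat iy 1).
have -> : 'D_(delta_mx 0 iy) F 0 =
    'D_(delta_mx 0 iy) (fun z : V => g (z 0 iy) + z 0 iy ^+ 1 * b z) 0.
  apply: eq_derive_line => t; rewrite Fypq_iy /b.
  have -> : (t *: delta_mx 0 iy : V) 0 iy = t by rewrite !mxE !eqxx mulr1.
  by rewrite expr1.
have b0 : b 0 = 0.
  have nz m : (1 <= m)%N -> ((2 * m).-1 == 0)%N = false by case: m => // m; rewrite mulnS.
  by rewrite /b mxE expr0n nz // mul0r.
apply: (etrans (deriveD dg (derivableM dy db))).
rewrite derive_coord_comp.
have -> : 'D_(delta_mx 0 iy) (fun z : V => z 0 iy ^+ 1 * b z) 0 = 0.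
  apply: (etrans (deriveM dy db)).
  by rewrite b0 mxE expr1 !scale0r addr0.
by rewrite addr0.
Qed.

(** On the $p_1$-axis only $p_1y^0$ survives, so $F=p_1$ there. This is the additional nonzero
    derivative that the model asks for. *)
Lemma derive_ip1_Fypq : 'D_(delta_mx 0 (ip 1)) F 0 = 1.
Proof.
have -> : 'D_(delta_mx 0 (ip 1)) F 0 = 'D_(delta_mx 0 (ip 1)) (fun z : V => z 0 (ip 1)) 0.
  apply: eq_derive_line => t; rewrite FE.
  have y0 : (t *: delta_mx 0 (ip 1) : V) 0 iy = 0.
    by rewrite !mxE eq_sym ip_iy ?mulr0 //= addn_gt0 n1.
  rewrite y0 g0 add0r expr0n muln_eq0 /= (gtn_eqF n1) mul0r addr0.
  rewrite big_ltn // mulnS /= expr0 mulr1 expr1 mulr0 addr0.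
  rewrite big_nat big1 ?addr0 // => i /andP[i2 _].
  (* For $i\ge2$ both exponents of $y=0$ are positive. *)
  by case: i i2 => [|[|i]] // _; rewrite !mulnS !expr0n !mulr0 addr0.
by have [] := derive_coord (ip 1) (ip 1) (0 : V); rewrite eqxx.
Qed.

Lemma higher_S1_kappa (mu : two_form R n.*2) : derive1 g 0 != 0 ->
  symplectic_germ cat mu ->
  in_S1 cat (triple_higher g phi mu) /\
  forall h : V -> R, defines_hyper cat h (hyper (triple_higher g phi mu)) ->
    kappa (triple_higher g phi mu) h = 1 / (2 * derive1 g 0).
Proof.
move=> dg smu; apply: (@model_S1_kappa R cat n F mu) => //.
- exact: of_class_Fypq.
- have := Fypq_iy 0; rewrite scale0r => ->.
  by rewrite g0 mul0r addr0.
- move=> z t; rewrite /F; congr (Fypq _ _ _); rewrite proj_ypqE.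
  by apply/rowP => j; rewrite !mxE eqxx /= mulr0 add0r.
- exact: derive_iy_Fypq.
- move=> _; exists (ip 1); first by rewrite ip_iy //= addn_gt0 n1.
  by rewrite derive_ip1_Fypq oner_eq0.
Qed.

End Higher.
End NormalForms.
Theorem proposition1p4 (R : realType) (cat : category) :
  (forall (m : nat) (T : triple R m), in_S1 cat T ->
     forall h h' : 'rV[R]_(m.*2) -> R,
       defines_hyper cat h (hyper T) -> defines_hyper cat h' (hyper T) ->
       kappa T h = kappa T h') /\
  (forall (m : nat) (T1 T2 : triple R m), in_S1 cat T1 -> in_S1 cat T2 ->
     equivalent cat T1 T2 ->
     forall h1 h2 : 'rV[R]_(m.*2) -> R,
       defines_hyper cat h1 (hyper T1) -> defines_hyper cat h2 (hyper T2) ->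
       kappa T1 h1 = kappa T2 h2) /\
  (forall g : R -> R,
     of_class cat (fun v : 'rV[R]_1 => g (v 0 0)) ->
     g 0 = 0 -> derive1 g 0 != 0 ->
     in_S1 cat (triple_plane g) /\
     forall h : 'rV[R]_(1.*2) -> R,
       defines_hyper cat h (hyper (triple_plane g)) ->
       kappa (triple_plane g) h = 1 / (2 * derive1 g 0)) /\
  (forall (n : nat) (g : R -> R) (phi : 'rV[R]_(n.*2.+1) -> R)
      (mu : two_form R n.*2),
     (1 <= n)%N ->
     of_class cat (fun v : 'rV[R]_1 => g (v 0 0)) ->
     g 0 = 0 -> derive1 g 0 != 0 ->
     of_class cat phi ->
     symplectic_germ cat mu ->
     in_S1 cat (triple_higher g phi mu) /\
     forall h : 'rV[R]_(n.+1.*2) -> R,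
       defines_hyper cat h (hyper (triple_higher g phi mu)) ->
       kappa (triple_higher g phi mu) h = 1 / (2 * derive1 g 0)).
Proof.
split; first by move=> m T TS h h'; exact: kappa_change_equation.
split; first by move=> m T1 T2 TS1 TS2 T12 h1 h2; exact: kappa_equivalent.
split; first by move=> g; exact: plane_S1_kappa.
by move=> n g phi mu n1 cg g0 dg cphi smu; exact: higher_S1_kappa.
Qed.
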